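(* Let $k$ be a positive integer. If $G$ is a finite simple 2-connected outerplanar graph on $n \geq 5$ vertices, then $c_{H,k}(G) \leq \sqrt{2n}$.
   Context: The $k$-hyperopic game of cops and robber ($k \ge 1$ an integer) on a finite connected simple graph $G$ is played by a team of cops (controlled by one player) and one robber, all occupying vertices of $G$. First the cops choose their starting vertices (several cops may share a vertex), then the robber chooses his starting vertex. Then the players alternate turns, cops first: on the cops' turn each cop stays or moves to an adjacent vertex; on the robber's turn he stays or moves to an adjacent vertex. The robber always sees the positions of all cops. The robber is invisible to the cops whenever every cop satisfies $1 \le d(r,c) \le k$, where $r$ and $c$ are the current positions of the robber and that cop and $d$ is graph distance; otherwise (in particular whenever some cop is at distance greater than $k$ from him) his position is known to all cops. The robber is omniscient: he knows the complete strategy of the cops in advance, so he is never captured by chance, i.e. a winning cop strategy must guarantee capture against every possible play of the robber. The cops win if after finitely many rounds some cop occupies the same vertex as the robber; otherwise the robber wins. The $k$-hyperopic cop number $c_{H,k}(G)$ is the minimum number of cops that have a winning strategy on $G$. *)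

(* Defs.v *)
From mathcomp Require Import all_boot all_order all_algebra.
From mathcomp Require Import all_classical all_reals all_analysis.
Set Implicit Arguments.
Unset Strict Implicit.
Unset Printing Implicit Defensive.
Import Order.TTheory GRing.Theory Num.Theory.
Import numFieldNormedType.Exports.

Local Open Scope classical_set_scope.
Local Open Scope ring_scope.

Record sgraph := SGraph {
  vertex :> finType;
  adj : rel vertex;
  adj_sym : symmetric adj;
  adj_irrefl : irreflexive adj }.

Section Graph.
Variable G : sgraph.

Definition connected_without (X : {set G}) :=
  forall x y : G, x \notin X -> y \notin X ->
    connect [rel u v : G | [&& adj u v, u \notin X & v \notin X]] x y.

Definition k_connected (k : nat) :=
  (k < #|G|)%N /\ forall X : {set G}, (#|X| < k)%N -> connected_without X.

(* Length of a shortest walk from x to y; walks shorter than #|G| suffice.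
   The value is the junk #|G| when y is unreachable, which does not happen in
   a connected graph. *)
Definition gdist (x y : G) : nat :=
  (\big[minn/#|G|]_(n < #|G| |
     [exists p : n.-tuple G, path (@adj G) x p && (last x p == y)]) n)%N.

Definition stay_or_adj (x y : G) := (x == y) || adj x y.

End Graph.

Section Game.
Variables (G : sgraph) (k m : nat).

Definition positions := {ffun 'I_m -> G}.

Definition captured (C : positions) (r : G) := [exists i, C i == r].

Definition invisible (C : positions) (r : G) :=
  [forall i, (1 <= gdist r (C i) <= k)%N].

Definition observation (C : positions) (r : G) : option G :=
  if invisible C r then None else Some r.

(* A strategy maps the observations made so far to the next positions of the
   cops; on [::] it gives the starting positions.  The past positions of the
   cops are a function of the strategy and of the observations, so they need
   not be recorded.  Strategies are deterministic: the robber knows them. *)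
Definition strategy := seq (option G) -> positions.

Section Play.
Variables (s : strategy) (r : nat -> G).

(* r 0 is the start of the robber and r t his vertex after t rounds.
   [history t] lists what the cops have observed after t rounds; in each round
   they observe once after their own move and once after that of the robber. *)
Fixpoint history (t : nat) : seq (option G) :=
  if t is u.+1 then
    let C := s (history u) in
    history u ++ [:: observation C (r u); observation C (r u.+1)]
  else [:: observation (s [::]) (r 0)].

Definition cop_positions (t : nat) : positions :=
  if t is u.+1 then s (history u) else s [::].

End Play.

Definition robber_walk (r : nat -> G) := forall t, stay_or_adj (r t) (r t.+1).

(* In round t.+1 the cops move to [cop_positions s r t.+1] while the robber is
   still at [r t]. *)
Definition winning (s : strategy) := forall r, robber_walk r ->
  (forall t i, stay_or_adj (cop_positions s r t i) (cop_positions s r t.+1 i))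
  /\ exists t, captured (cop_positions s r t) (r t)
               || captured (cop_positions s r t.+1) (r t).

End Game.

Definition cops_win (G : sgraph) (k m : nat) :=
  exists s : strategy G m, winning k s.

Lemma cops_win_ex (G : sgraph) (k : nat) : exists m, `[< cops_win G k m >].
Proof.
exists #|G|; apply/asboolP; exists (fun=> [ffun i => enum_val i]) => r _; split.
  by move=> [|t] i; rewrite /stay_or_adj eqxx.
exists 0; apply/orP; left; apply/existsP; exists (enum_rank (r 0)).
by rewrite ffunE enum_rankK.
Qed.

Definition hyperopic_cop_number (G : sgraph) (k : nat) : nat :=
  ex_minn (cops_win_ex G k).

Section Outerplanar.
Variables (R : realType) (G : sgraph).

Record drawing := Drawing {
  pt : G -> R * R;
  (* [curve x y] runs from pt x to pt y; irrelevant unless adj x y *)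
  curve : G -> G -> R -> R * R;
  pt_inj : injective pt;
  curve_continuous : forall x y, adj x y -> {within `[0, 1], continuous (curve x y)};
  curve_inj : forall x y, adj x y -> {in `[0, 1] &, injective (curve x y)};
  curve_start : forall x y, adj x y -> curve x y 0 = pt x;
  curve_end : forall x y, adj x y -> curve x y 1 = pt y;
  curve_rev : forall x y, adj x y -> {in `[0, 1], forall t, curve y x t = curve x y (1 - t)};
  curve_avoids_pt : forall x y z, adj x y ->
    {in `]0, 1[, forall t, curve x y t <> pt z};
  curve_disjoint : forall x y u v, adj x y -> adj u v ->
    (u, v) <> (x, y) -> (u, v) <> (y, x) ->
    {in `]0, 1[ &, forall t t', curve x y t <> curve u v t'} }.

Definition drawn (d : drawing) : set (R * R) :=
  range (pt d) `|` [set p | exists x y (t : R), [/\ adj x y, t \in `[0, 1] & p = curve d x y t]].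

Definition face (d : drawing) (F : set (R * R)) :=
  exists2 p, (~` drawn d) p & F = connected_component (~` drawn d) p.

Definition outerplanar := exists d : drawing, exists F : set (R * R),
  [/\ face d F, ~ bounded_set F & forall x, closure F (pt d x)].

End Outerplanar.

(* Main.v *)
Require Import Defs.
From mathcomp Require Import all_boot all_order all_algebra.
From mathcomp Require Import all_classical all_reals all_analysis.
From mathcomp Require Import zify lra.
Import Order.TTheory GRing.Theory Num.Theory.
Import numFieldNormedType.Exports.
Set Implicit Arguments.
Unset Strict Implicit.
Unset Printing Implicit Defensive.

(** The cops do not need to see the robber: m cops win whenever
    m ^ 2 <= 2 n < (m + 1) ^ 2, by a fixed search that ignores all
    observations.

    A 2-connected outerplanar graph contains no theta, that is, no three
    internally disjoint paths with the same two ends, each with an inner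
    vertex ([outerplanar_theta_free]).  In a 2-connected theta-free graph a
    longest cycle is Hamiltonian: a path leaving and reentering it at
    non-consecutive vertices would form a theta, and at consecutive vertices
    it would lengthen the cycle ([hamiltonian]).  If n >= 5, two crossing
    chords of a Hamiltonian cycle also produce a theta
    ([hamiltonian_noncrossing]).  The graph is thus a polygon with
    noncrossing chords, and each of its arcs is organised as a binary tree
    ([arc_dtree]), as in the weak dual of a triangulated polygon: the ends of
    an arc separate its inside from the rest, and a further vertex of the arc
    separates the inside into two smaller arcs.

    A search is described by the set of vertices where the robber may be.  To
    clear an arc whose two ends are held, send a free cop to the vertex that
    splits it, clear one half, then the other.  What matters is which of the
    end cops must hold their ground for the sake of the rest of the graph.
    With p cops allowed to move, an arc is cleared if it has at most 2p, or
    (p + 2)^2/4 - 1, or p^2/2 inner vertices, according to whether none, one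
    or both of its end cops are among these p ([clearable_all]).  Two vertices
    x and y are then chosen so that one of the two arcs between them has
    between m - 2 and 2(m - 2) - 1 inner vertices ([two_arcs]): m - 2 cops
    clear it while x and y are held, and all m cops, now free to move, clear
    the other one, which has at most n - m <= m^2/2 inner vertices
    ([theta_free_cops_win]).

    The absence of thetas is where the topology of the plane enters, and it is
    proved by winding numbers, for arbitrary continuous curves.  Suppose that
    paths P1, P2, P3 from a to b are disjoint except at their ends, and that
    xi lies inside Pi.  On the rectangles [0, si] * [sj, 1] and
    [si, 1] * [0, sj], which meet where (s, t) = (si, sj), the difference
    Pi s - Pj t does not vanish, hence has a continuous argument.  Between the
    parameters (0, 1) and (1, 0), where the difference is a - b and b - a, the
    argument changes by an odd multiple Dij of a half turn.  Computing the
    winding numbers along these rectangles, the contributions of the ends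
    cancel and
      w12(x3) + w23(x1) + w31(x2) = 2 (D13 - D12 - D23)
    where wij(x) is the winding around x, counted in half turns, of Pi followed
    by the reverse of Pj.
    If x1, x2, x3 are in the closure of one connected set F off the paths,
    wij may be computed at any f in F, where the sum telescopes to 0; but
    D13 - D12 - D23 is odd ([theta_face]).  Arguments are measured in quarter
    turns, by integers congruent to the quadrant modulo 4 ([lift]). *)

(** * Theta-free graphs are polygons with noncrossing chords *)

(** Compares multiplicities.  The truth values counted are generalized because
    [lia] would branch on each of them. *)
Ltac permute_by_count := apply/permP => ?;
  rewrite -?cats1; do 4 rewrite /= ?(count_cat, count_rev);
  repeat match goal with |- context [nat_of_bool ?b] =>
    generalize (nat_of_bool b); intro end; lia.

Section Structure.
Variable G : sgraph.
Implicit Types (a b c u v w x y z : G) (p q s : seq G).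

(** Stated as a disjunction: of three internally disjoint paths one has no
    inner vertex.  For 2-connected graphs this excludes the subdivisions of
    K(2,3), one of the two obstructions to outerplanarity; the other one, K4,
    matters only when there are fewer than five vertices. *)
Definition theta_free := forall a b p1 p2 p3,
  path (@adj G) a (rcons p1 b) -> path (@adj G) a (rcons p2 b) ->
  path (@adj G) a (rcons p3 b) -> uniq (a :: b :: p1 ++ p2 ++ p3) ->
  [|| p1 == [::], p2 == [::] | p3 == [::]].

Lemma path_rcons_rev a b p :
  path (@adj G) b (rcons (rev p) a) = path (@adj G) a (rcons p b).
Proof.
have := rev_path (@adj G) a (rcons p b).
rewrite last_rcons belast_rcons rev_cons => ->.
by apply: eq_path => u v; exact: adj_sym.
Qed.

Lemma cycle_cat a b p q : cycle (@adj G) (a :: p ++ b :: q) =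
  path (@adj G) a (rcons p b) && path (@adj G) b (rcons q a).
Proof. by rewrite /= rcons_cat cat_path /= [path _ a (rcons p b)]rcons_path andbA. Qed.

Lemma path_crossing (A : pred G) u p : path (@adj G) u p -> ~~ A u ->
  A (last u p) -> exists v x, [/\ adj v x, ~~ A v & A x].
Proof.
elim: p u => [|y p IH] u /=; first by move=> _ /negbTE ->.
move=> /andP[uy yp] nu; case Ay : (A y); last by apply: IH; rewrite ?Ay.
by move=> _; exists u, y; split; rewrite ?Ay.
Qed.

Lemma first_hit (A : pred G) p : has A p ->
  exists p1 x p2, [/\ p = p1 ++ x :: p2, A x & ~~ has A p1].
Proof.
elim: p => //= y p IH; case Ay : (A y) => /= h; first by exists [::], y, p.
by have [p1 [x [p2 [-> Ax nA]]]] := IH h; exists (y :: p1), x, p2; rewrite /= Ay.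
Qed.

Lemma last_hit (A : pred G) p : has A p ->
  exists p1 x p2, [/\ p = p1 ++ x :: p2, A x & ~~ has A p2].
Proof.
rewrite -has_rev => /first_hit[p1 [x [p2 [e Ax nA]]]].
exists (rev p2), x, (rev p1); rewrite has_rev; split=> //.
by rewrite -(revK p) e rev_cat rev_cons cat_rcons.
Qed.

Lemma longest_cycle x y : adj x y -> exists s,
  [/\ ucycle (@adj G) s, 1 < size s &
    forall s', ucycle (@adj G) s' -> size s' <= size s].
Proof.
move=> xy.
pose P n := [exists t : n.-tuple G, ucycleb (@adj G) t].
have PS s : ucycleb (@adj G) s -> P (size s).
  by move=> us; apply/existsP; exists (in_tuple s).
have P2 : P 2.
  apply: (PS [:: x; y]); rewrite /ucycleb /= xy adj_sym xy inE !andbT.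
  by apply/eqP => e; rewrite e adj_irrefl in xy.
have Pub n : P n -> n <= #|G|.
  move=> /existsP[t /andP[_ ut]]; rewrite -(size_tuple t).
  by rewrite -(card_uniqP ut) max_card.
case: (ex_maxnP (ex_intro _ 2 P2) Pub) => n /existsP[t ut] tmax.
exists t; rewrite size_tuple; split=> //; first exact: tmax.
by move=> s' /PS/tmax.
Qed.

(** An ear on a cycle between x and y: the two arcs of the cycle and the ear
    would be a theta, so x and y are consecutive and the ear can replace the
    edge between them. *)
Lemma ear v x y q s1 s2 : theta_free ->
  ucycle (@adj G) (x :: s1 ++ y :: s2) ->
  adj x v -> path (@adj G) v (rcons q y) -> uniq (v :: q) ->
  ~~ has (mem (x :: s1 ++ y :: s2)) (v :: q) ->
  exists2 s', ucycle (@adj G) s' & size (x :: s1 ++ y :: s2) < size s'.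
Proof.
move=> tf /andP[cs us] xv vq uq dis.
move: cs; rewrite cycle_cat => /andP[c1 c2].
have c3 : path (@adj G) x (rcons (v :: q) y) by rewrite /= xv.
have uall : uniq ((x :: s1 ++ y :: s2) ++ v :: q) by rewrite cat_uniq us dis uq.
have := tf x y s1 (rev s2) (v :: q) c1; rewrite path_rcons_rev => /(_ c2 c3).
have -> : uniq [:: x, y & s1 ++ rev s2 ++ v :: q].
  rewrite -(perm_uniq (_ : perm_eq ((x :: s1 ++ y :: s2) ++ v :: q) _)) //.
  permute_by_count.
move=> /(_ isT); rewrite orbF => /orP[/eqP e1|].
  rewrite e1 in us uall c1 *; exists (x :: (v :: q) ++ y :: s2);
    last by rewrite /= size_cat /=; lia.
  apply/andP; split; first by rewrite cycle_cat c3 c2.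
  rewrite -(perm_uniq (_ : perm_eq ((x :: [::] ++ y :: s2) ++ v :: q) _)) //.
  permute_by_count.
rewrite -size_eq0 size_rev size_eq0 => /eqP e2.
rewrite e2 in us uall c2 *; exists (x :: s1 ++ y :: rev (v :: q));
  last by rewrite /= !size_cat /= size_rev /=; lia.
apply/andP; split; first by rewrite cycle_cat c1 path_rcons_rev c3.
rewrite -(perm_uniq (_ : perm_eq ((x :: s1 ++ [:: y]) ++ v :: q) _)) //.
permute_by_count.
Qed.

Lemma connected_path (X : {set G}) x y : connected_without X ->
  x \notin X -> y \notin X -> exists p, [/\ path (@adj G) x p, uniq (x :: p),
    last x p = y & forall z, z \in p -> z \notin X].
Proof.
move=> cX xX yX; have /connectP[p0 pp ->] := cX x y xX yX.
case/shortenP: pp => p pp up _; exists p; split=> //.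
  by apply: sub_path pp => u v /andP[].
elim: p x pp {up xX} => [|v p IH] x //= /andP[/and3P[_ _ vX] pp] z.
by rewrite inE => /predU1P[->|/(IH _ pp)].
Qed.

(** If a longest cycle misses a vertex, some v off the cycle is adjacent to x
    on it.  Removing x does not disconnect v from the cycle, so that v starts
    a path back to the cycle that ends at another vertex than x: this is an
    ear, which gives a longer cycle. *)
Lemma hamiltonian : k_connected G 2 -> theta_free -> exists s,
  [/\ cycle (@adj G) s, uniq s & forall x, x \in s].
Proof.
move=> [G2 conn] tf.
have conn0 : connected_without (finset.set0 : {set G}) by apply: conn; rewrite finset.cards0.
have conn1 x : connected_without (finset.set1 x) by apply: conn; rewrite finset.cards1.
have /card_gt1P[x0 [y0 [_ _ xy0]]] : 1 < #|G| by exact: ltnW.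
have [||[|z p] [pp _ lp _]] := connected_path (x := x0) (y := y0) conn0; rewrite ?inE //.
  by rewrite -lp eqxx in xy0.
have [s [/andP[cs us] s2 smax]] : exists s, [/\ ucycle (@adj G) s, 1 < size s &
    forall s', ucycle (@adj G) s' -> size s' <= size s].
  by move: pp => /= /andP[x0z _]; exact: longest_cycle x0z.
exists s; split=> // w; apply: contraT => ws.
have [p1 [pp1 _ lp1 _]] : exists p, [/\ path (@adj G) w p, uniq (w :: p),
    last w p = head x0 s & forall z, z \in p -> z \notin (finset.set0 : {set G})].
  by apply: connected_path; rewrite ?inE.
have ls : last w p1 \in s by rewrite lp1; case: (s) s2 => //= ? ? _; rewrite mem_head.
(* v is off the cycle and adjacent to x on the cycle *)
have [v [x [vx vs xs]]] := path_crossing pp1 ws ls.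
have {}vs : v \notin s := vs.
have [i s' es] := rot_to xs.
(* a target on the cycle that the path from v must reach without using x *)
have [y [ys' yx]] : exists y, y \in s' /\ y != x.
  case: s' es => [|y s'] es; first by move: s2; rewrite -(size_rot i) es.
  exists y; rewrite mem_head; split=> //; apply/eqP => e.
  by move: us; rewrite -(rot_uniq i) es e /= mem_head.
have mems t : (t \in x :: s') = (t \in s) by rewrite -es mem_rot.
have vx' : v != x by apply: contraNneq vs => ->.
have [||q [pq uq lq qx]] := connected_path (x := v) (y := y) (conn1 x).
- by rewrite finset.in_set1.
- by rewrite finset.in_set1.
have hq : has (mem s) q.
  apply/hasP; exists y; last by rewrite /= -mems inE ys' orbT.
  by move: lq vs; case/lastP: (q) => [/= ->|? ? <- _]; 
    [rewrite -mems inE ys' orbT|rewrite last_rcons mem_rcons mem_head].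
have [q1 [y1 [q2 [eq ys nq1]]]] := first_hit hq.
have y1x : y1 != x by have := qx y1; rewrite eq mem_cat mem_head orbT finset.in_set1 => /(_ isT).
have y1s' : y1 \in s' by move: ys; rewrite /= -mems inE (negbTE y1x).
have [s1 [s2' es']] : exists s1 s2', s' = s1 ++ y1 :: s2'.
  by case/splitPr: y1s' => s1 s2'; exists s1, s2'.
have [|||||t ut st] := @ear v x y1 q1 s1 s2' tf.
- by rewrite -es' -es; apply/andP; rewrite rot_cycle rot_uniq.
- by rewrite adj_sym.
- by move: pq; rewrite eq -cat_rcons cat_path => /andP[].
- by move: uq; rewrite eq -cat_cons cat_uniq => /andP[].
- rewrite -es' -es (eq_has (a2 := mem s)); last by move=> ?; rewrite /= mem_rot.
  by rewrite /= negb_or vs.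
by have := smax t ut; rewrite -(size_rot i s) es es' leqNgt st.
Qed.

(** On four positions in order, the chords i k and j l cross.  Through
    [subseq] the property passes to arcs without any reindexing. *)
Definition noncrossing s := forall i j k l, subseq [:: i; j; k; l] s ->
  adj i k -> adj j l -> False.

(** If p1 is not empty, then i and j are the ends of a theta: p1 itself, the
    chord i k followed by the way back from k to j, and the way back from i to
    l followed by the chord l j. *)
Lemma crossing_theta i j k l p1 p2 p3 p4 : theta_free ->
  cycle (@adj G) (i :: p1 ++ j :: p2 ++ k :: p3 ++ l :: p4) ->
  uniq (i :: p1 ++ j :: p2 ++ k :: p3 ++ l :: p4) ->
  adj i k -> adj j l -> p1 = [::].
Proof.
move=> tf; rewrite cycle_cat => /andP[c1].
rewrite rcons_cat /= -cat_rcons cat_path last_rcons.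
rewrite rcons_cat /= -cat_rcons cat_path last_rcons => /and3P[c2 _ c4] us ik jl.
have c2' : path (@adj G) i (rcons (k :: rev p2) j) by rewrite /= ik path_rcons_rev.
have c4' : path (@adj G) i (rcons (rcons (rev p4) l) j).
  by rewrite rcons_path path_rcons_rev c4 last_rcons adj_sym.
have := tf i j p1 (k :: rev p2) (rcons (rev p4) l) c1 c2' c4'.
have -> : uniq [:: i, j & p1 ++ (k :: rev p2) ++ rcons (rev p4) l].
  suff : uniq ([:: i, j & p1 ++ (k :: rev p2) ++ rcons (rev p4) l] ++ p3).
    by rewrite cat_uniq => /and3P[-> _ _].
  rewrite -(perm_uniq
    (_ : perm_eq (i :: p1 ++ j :: p2 ++ k :: p3 ++ l :: p4) _)) //.
  permute_by_count.
by case: p1 {us c1} => // ? ? /(_ isT); rewrite /= -size_eq0 size_rcons.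
Qed.

Lemma subseq_consE x t s : subseq (x :: t) s ->
  exists s1 s2, s = s1 ++ x :: s2 /\ subseq t s2.
Proof.
elim: s => //= y s IH; case: eqP => [->|_] h; first by exists [::], s.
by have [s1 [s2 [-> h2]]] := IH h; exists (y :: s1), s2.
Qed.

(** There are four gaps between the ends of two crossing chords, and with
    five vertices one of the gaps is not empty; rotating the cycle brings it to
    the front. *)
Lemma hamiltonian_noncrossing s : theta_free -> 5 <= #|G| ->
  cycle (@adj G) s -> uniq s -> (forall x, x \in s) -> noncrossing s.
Proof.
move=> tf G5 cs us alls i j k l /subseq_consE[p0 [t1 [es /subseq_consE[p1 [t2 [e1
  /subseq_consE[p2 [t3 [e2 /subseq_consE[p3 [p4 [e3 _]]]]]]]]]]]] ik jl.
have sz : 5 <= size s by rewrite -(card_uniqP us) (eq_card (B := G)).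
have er : rot (size p0) s = i :: p1 ++ j :: p2 ++ k :: p3 ++ l :: (p4 ++ p0).
  by rewrite es rot_size_cat e1 e2 e3 /= -!catA /= -!catA /= -!catA.
move: cs us sz; rewrite -(rot_cycle (size p0)) -(rot_uniq (size p0)) -(size_rot (size p0) s) er.
move: (p4 ++ p0) => q4 cs us sz.
have turn p q : cycle (@adj G) (p ++ q) -> uniq (p ++ q) ->
    cycle (@adj G) (q ++ p) /\ uniq (q ++ p).
  by rewrite -(rot_cycle (size p)) -(rot_uniq (size p)) rot_size_cat.
have ki : adj k i by rewrite adj_sym.
have lj : adj l j by rewrite adj_sym.
have n1 : p1 = [::] by exact: crossing_theta tf cs us ik jl.
have n2 : p2 = [::].
  have [] := turn (i :: p1) _ cs us; rewrite cat_cons -catA cat_cons -catA cat_cons.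
  by move=> cs' us'; exact: crossing_theta tf cs' us' jl ki.
rewrite n1 n2 !cat0s in cs us sz.
have n3 : p3 = [::].
  have [] := turn [:: i; j] (k :: p3 ++ l :: q4) cs us; rewrite cat_cons -catA cat_cons.
  by move=> cs' us'; exact: (@crossing_theta k l i j p3 q4 [::] [::]).
have n4 : q4 = [::].
  rewrite n3 cat0s in cs us.
  have [] := turn [:: i; j; k] (l :: q4) cs us; rewrite cat_cons.
  by move=> cs' us'; exact: (@crossing_theta l i j k q4 [::] [::] [::]).
by move: sz; rewrite n3 n4.
Qed.

End Structure.

(** The dissection of an arc: a node holds the vertex that splits the arc. *)
Inductive dtree (G : sgraph) := Leaf | Node of dtree G & G & dtree G.
Arguments Leaf {G}.

Section Trees.
Variable G : sgraph.
Implicit Types (a b c u v x y z : G) (p q s I : seq G) (t l r : dtree G).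

Fixpoint flat t := if t is Node l c r then flat l ++ c :: flat r else [::].

Fixpoint mirror t : dtree G :=
  if t is Node l c r then Node (mirror r) c (mirror l) else Leaf.

(** The vertices of I have no neighbour outside I except a and b, so that
    cops on a and b confine a robber who is in I. *)
Definition walled a b I := forall u v, u \in I -> adj u v ->
  [|| v \in I, v == a | v == b].

(** A leaf is an arc without inner vertex; it is an edge of the Hamiltonian
    cycle, along which a cop can slide. *)
Fixpoint valid a b t : Prop := match t with
  | Leaf => adj a b
  | Node l c r => [/\ walled a c (flat l), walled c b (flat r), valid a c l &
                     valid c b r]
  end.

Lemma flat_mirror t : flat (mirror t) = rev (flat t).
Proof. by elim: t => //= l -> c r ->; rewrite rev_cat rev_cons cat_rcons. Qed.

Lemma walled_sym a b I J : I =i J -> walled a b I -> walled b a J.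
Proof.
by move=> IJ wI u v; rewrite -!IJ => uI uv; rewrite [_ || (v == a)]orbC; exact: wI uI uv.
Qed.

Lemma valid_mirror t a b : valid a b t -> valid b a (mirror t).
Proof.
elim: t a b => [a b|l IHl c r IHr a b] /=; first by rewrite adj_sym.
move=> [wl wr vl vr]; split; [| |exact: IHr|exact: IHl].
  by apply: walled_sym wr => z; rewrite flat_mirror mem_rev.
by apply: walled_sym wl => z; rewrite flat_mirror mem_rev.
Qed.

Lemma noncrossing_sub s s' : subseq s' s -> noncrossing s -> noncrossing s'.
Proof. by move=> ss nc i j k l h; apply: nc; exact: subseq_trans h ss. Qed.

(** The splitting vertex is the last inner neighbour c of a: an edge passing
    over c would start strictly after a, hence cross the chord a c, or start at
    a, against the choice of c. *)
Lemma arc_dtree n I a b : size I <= n -> path (@adj G) a (rcons I b) ->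
  noncrossing (a :: rcons I b) -> walled a b I ->
  exists t, flat t = I /\ valid a b t.
Proof.
elim: n I a b => [|n IH] I a b.
  rewrite leqn0 => /nilP -> /=; rewrite andbT => ab _ _; by exists Leaf.
case: I => [|z I]; first by rewrite /= andbT => _ ab _ _; exists Leaf.
move=> sI pI nc wI.
have : has (adj a) (z :: I) by move: pI => /= /andP[->].
move=> /last_hit[I1 [c [I2 [eI ac nI2]]]].
have sz : size I1 + size I2 <= n by move: sI; rewrite eI size_cat /= addnS.
rewrite eI in pI nc wI.
move: pI; rewrite -cat_rcons rcons_cat cat_path last_rcons => /andP[p1 p2].
have w1 : walled a c I1.
  move=> u v uI uv; have := wI u v; rewrite mem_cat uI => /(_ isT uv).
  rewrite mem_cat inE => /or3P[/or3P[->|->|vI]|->|/eqP vb]; rewrite ?orbT //; exfalso.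
    apply: (nc a u c v) => //; rewrite /= eqxx rcons_cat; apply: (@cat_subseq _ [:: u]).
      by rewrite sub1seq.
    by rewrite /= eqxx sub1seq mem_rcons inE vI orbT.
  apply: (nc a u c v) => //; rewrite /= eqxx rcons_cat; apply: (@cat_subseq _ [:: u]).
    by rewrite sub1seq.
  by rewrite /= eqxx sub1seq mem_rcons inE vb eqxx.
have w2 : walled c b I2.
  move=> u v uI uv; have := wI u v; rewrite mem_cat inE uI !orbT => /(_ isT uv).
  rewrite mem_cat inE => /or3P[/or3P[vI|->|->]|/eqP va|->]; rewrite ?orbT //; exfalso.
    apply: (nc a v c u) => //; last by rewrite adj_sym.
    rewrite /= eqxx rcons_cat; apply: (@cat_subseq _ [:: v]).
      by rewrite sub1seq.
    by rewrite /= eqxx sub1seq mem_rcons inE uI orbT.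
  by move/hasPn: nI2 => /(_ u uI); rewrite adj_sym -va uv.
have [||l [fl vl]] := IH I1 a c _ p1 _ w1; first by lia.
  apply: noncrossing_sub nc; rewrite /= eqxx rcons_cat -cats1.
  by apply: cat_subseq => //=; rewrite eqxx sub0seq.
have [||r [fr vr]] := IH I2 c b _ p2 _ w2; first by lia.
  apply: noncrossing_sub nc; rewrite rcons_cat -cat_cons.
  exact: suffix_subseq.
by exists (Node l c r); rewrite /= fl fr.
Qed.

(** A node with at least 2n inner vertices has a half with at least n of
    them, so the descent into such halves meets a size between n and 2n - 1. *)
Lemma subtree_between n t a b : 0 < n -> valid a b t -> walled a b (flat t) ->
  n <= size (flat t) -> exists x y (t' : dtree G) w1 w2,
    [/\ a :: rcons (flat t) b = w1 ++ x :: flat t' ++ y :: w2, valid x y t',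
        walled x y (flat t') & n <= size (flat t') < n.*2].
Proof.
move=> n0; elim: t a b => [|l IHl c r IHr] a b /=; first by rewrite leqNgt n0.
move=> [wl wr vl vr] wt nt.
have [small|big] := ltnP (size (flat l ++ c :: flat r)) n.*2.
  by exists a, b, (Node l c r), [::], [::]; split=> //=; rewrite ?cats1 ?nt.
have [nl|nl] := leqP n (size (flat l)).
  have [x [y [t' [w1 [w2 [e vs ws ns]]]]]] := IHl a c vl wl nl.
  exists x, y, t', w1, (w2 ++ rcons (flat r) b); split=> //.
  by rewrite -cat_rcons rcons_cat -cat_cons e -!catA /= -!catA.
have [|x [y [t' [w1 [w2 [e vs ws ns]]]]]] := IHr c b vr wr.
  by move: big; rewrite size_cat /=; lia.
exists x, y, t', (a :: flat l ++ w1), w2; split=> //=.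
by rewrite rcons_cat rcons_cons e -!catA.
Qed.

End Trees.

(** The first arc is a node of suitable size in the dissection of the graph;
    the second one is the rest of the Hamiltonian cycle, dissected anew. *)
Lemma two_arcs (G : sgraph) n : k_connected G 2 -> theta_free G ->
  5 <= #|G| -> 0 < n -> n.+2 <= #|G| ->
  exists (x y : G) (t t' : dtree G),
    [/\ valid x y t /\ walled x y (flat t),
        valid y x t' /\ walled y x (flat t'),
        size (flat t) + size (flat t') + 2 = #|G|, n <= size (flat t) < n.*2 &
        forall z, [|| z \in flat t, z \in flat t', z == x | z == y]].
Proof.
move=> kG tf G5 n0 nG; have [s [cs us alls]] := hamiltonian kG tf.
have sz : size s = #|G| by rewrite -(card_uniqP us); apply: eq_card => z; rewrite alls.
have nc := hamiltonian_noncrossing tf G5 cs us alls.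
case: s cs us alls sz nc => [|a s]; first by move=> _ _ _ sz; rewrite -sz in G5.
case/lastP: s => [|I b]; first by move=> _ _ _ sz; rewrite -sz in G5.
move=> cs us alls sz nc.
have wI : walled a b I.
  by move=> u v _ _; have := alls v; rewrite inE mem_rcons inE => /or3P[]->; rewrite ?orbT.
have pI : path (@adj G) a (rcons I b).
  by move: cs; rewrite /= rcons_path => /andP[].
have [t [ft vt]] := arc_dtree (leqnn _) pI nc wI.
have [||x [y [tA [w1 [w2 [e vA wA nA]]]]]] := subtree_between n0 vt.
- by rewrite ft.
- by rewrite ft; move: nG; rewrite -sz /= size_rcons !ltnS.
rewrite ft in e.
(* the same cycle read from y, so that the second arc comes first *)
pose s2 := (y :: w2 ++ w1) ++ x :: flat tA.
have es2 : s2 = rot (size (w1 ++ x :: flat tA)) (a :: rcons I b).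
  by rewrite e -cat_cons catA rot_size_cat /s2 /= -catA.
have cs2 : cycle (@adj G) s2 by rewrite es2 rot_cycle.
have us2 : uniq s2 by rewrite es2 rot_uniq.
have alls2 z : z \in s2 by rewrite es2 mem_rot.
have nc2 := hamiltonian_noncrossing tf G5 cs2 us2 alls2.
have wB : walled y x (w2 ++ w1).
  move=> u v uB uv; have := alls2 v; rewrite /s2 cat_cons inE mem_cat [v \in x :: _]inE.
  case/or4P => [->|->|->|vA']; rewrite ?orbT //; exfalso.
  have := wA v u vA'; rewrite adj_sym => /(_ uv).
  move: us2; rewrite /s2 cat_cons cons_uniq cat_uniq => /and4P[yn _ /hasPn dis _].
  case/or3P => [uA|/eqP ux|/eqP uy].
  - by have := dis u; rewrite inE uA orbT /= uB => /(_ isT).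
  - by have := dis u; rewrite inE ux eqxx /= -ux uB => /(_ isT).
  - by move: yn; rewrite mem_cat -uy uB.
have [||tB [fB vB]] := arc_dtree (leqnn _) _ _ wB.
- by move: cs2; rewrite /s2 cycle_cat => /andP[].
- apply: noncrossing_sub nc2; rewrite /s2 -cats1 -cat_cons.
  by apply: cat_subseq; rewrite // sub1seq mem_head.
exists x, y, tA, tB; rewrite fB; split=> //.
  rewrite -sz -(size_rot (size (w1 ++ x :: flat tA)) (a :: _)) -es2 /s2 size_cat /=.
  by rewrite !size_cat /=; lia.
move=> z; have := alls2 z; rewrite /s2 cat_cons inE mem_cat [z \in x :: _]inE.
by case/or4P => ->; rewrite ?orbT.
Qed.

(** * Searching an outerplanar graph without seeing the robber *)

Section Clearing.
Variables (G : sgraph) (m : nat).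
Implicit Types (C : positions G m) (S : pred G) (i j : 'I_m) (M : {set 'I_m})
  (u v w : G).

(** [clears C S]: cops at C, with the robber at an unknown vertex of S after
    his own move, have a blind winning plan. *)
Inductive clears C S : Prop :=
| clears_done of (forall v, S v -> captured C v)
| clears_step C' S' of (forall i, stay_or_adj (C i) (C' i)) &
    (forall u v, S u -> ~~ captured C u -> ~~ captured C' u ->
       stay_or_adj u v -> captured C' v || S' v) &
    clears C' S'.

Lemma clears_sub C S S' : (forall v, S' v -> captured C v || S v) ->
  clears C S -> clears C S'.
Proof.
move=> SS' [Sdone|C' T mv ST cl].
  by apply: clears_done => v /SS'/orP[|/Sdone].
apply: clears_step mv _ cl => u v /SS' + nC; rewrite (negbTE nC) /= => Su.
exact: ST.
Qed.

(** A blind plan is just a sequence of positions; the robber may know it. *)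
Lemma clears_plan C S : clears C S -> exists c : nat -> positions G m,
  [/\ c 0 = C, (forall t i, stay_or_adj (c t i) (c t.+1 i)) &
    forall r, robber_walk r -> S (r 0) ->
      exists t, captured (c t) (r t) || captured (c t.+1) (r t)].
Proof.
elim=> {C S} [C S Sdone|C S C' S' mv SS' _ [c [c0 cmv cwin]]].
  exists (fun=> C); split=> // [t i|r _ /Sdone h]; first by rewrite /stay_or_adj eqxx.
  by exists 0; rewrite h.
exists (fun t => if t is u.+1 then c u else C); split=> //.
  by move=> [|t] i; [rewrite c0|exact: cmv].
move=> r wr r0.
have [h|n0] := boolP (captured C (r 0)); first by exists 0; rewrite h.
have [h|n1] := boolP (captured C' (r 0)); first by exists 0; rewrite c0 h orbT.
have /orP[h|r1] := SS' _ _ r0 n0 n1 (wr 0); first by exists 1; rewrite c0 h.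
have [t ht] := cwin (fun t => r t.+1) (fun t => wr t.+1) r1.
by exists t.+1.
Qed.

Lemma clears_cops_win C k : clears C predT -> cops_win G k m.
Proof.
move=> /clears_plan[c [_ cmv cwin]]; exists (fun h => c (size h).+1./2).
move=> r wr.
have cE t : cop_positions k (fun h => c (size h).+1./2) r t = c t.
  case: t => //= t; congr c.
  suff -> : size (history k (fun h => c (size h).+1./2) r t) = t.*2.+1.
    by rewrite -[in RHS](doubleK t.+1).
  by elim: t => //= t IH; rewrite size_cat IH /= addn2.
split; first by move=> t i; rewrite !cE.
by have [t ht] := cwin r wr isT; exists t; rewrite !cE.
Qed.

Definition upd C i v : positions G m := [ffun j => if j == i then v else C j].

Lemma updE C i v j : upd C i v j = if j == i then v else C j.
Proof. by rewrite ffunE. Qed.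

Lemma capturedP C v : reflect (exists i, C i = v) (captured C v).
Proof. by apply: (iffP existsP) => -[i /eqP]; exists i => //; apply/eqP. Qed.

(** The move catches a robber at c, so only the moves of robbers elsewhere
    count; this is what allows a cop to give up its place. *)
Lemma clears_slide C S S' i c : adj (C i) c ->
  (forall u v, S u -> u != c -> stay_or_adj u v ->
     [\/ S' v, v = c | exists2 j, j != i & C j = v]) ->
  clears (upd C i c) S' -> clears C S.
Proof.
move=> ic SS' cl; apply: clears_step _ _ cl.
  move=> j; rewrite updE; case: eqP => [->|_]; rewrite /stay_or_adj ?eqxx //.
  by rewrite ic orbT.
move=> u v Su _ nu uv.
have uc : u != c by apply: contraNneq nu => ->; apply/capturedP; exists i; rewrite updE eqxx.
case: (SS' u v Su uc uv) => [->|->|[j ji <-]]; rewrite ?orbT //; apply/orP; left; apply/capturedP.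
  by exists i; rewrite updE eqxx.
by exists j; rewrite updE (negbTE ji).
Qed.

(** A cop that guards nothing may walk anywhere. *)
Lemma clears_walk C S i p : path (@adj G) (C i) p ->
  (forall u v, S u -> adj u v -> S v \/ exists2 j, j != i & C j = v) ->
  clears (upd C i (last (C i) p)) S -> clears C S.
Proof.
move=> + guard; elim: p C guard => [|y p IH] C guard /=.
  suff -> : upd C i (C i) = C by [].
  by apply/ffunP => j; rewrite updE; case: eqP => [->|].
move=> /andP[iy yp] cl; apply: (@clears_slide C S S i y) => //.
  move=> u v Su _ /orP[/eqP<-|uv]; first by constructor 1.
  by case: (guard u v Su uv); [constructor 1|constructor 3].
apply: IH; rewrite ?updE ?eqxx //.
  move=> u v Su uv; case: (guard u v Su uv) => [|[j ji jv]]; first by left.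
  by right; exists j; rewrite ?updE ?(negbTE ji).
suff -> : upd (upd C i y) i (last y p) = upd C i (last y p) by [].
by apply/ffunP => j; rewrite !updE; case: eqP.
Qed.

Hypothesis Gconn : forall x y : G, exists2 p, path (@adj G) x p & last x p = y.

Lemma clears_place C S i v :
  (forall u w, S u -> adj u w -> S w \/ exists2 j, j != i & C j = w) ->
  clears (upd C i v) S -> clears C S.
Proof.
by move=> guard; have [p pp <-] := Gconn (C i) v; exact: clears_walk.
Qed.

(** The number of inner vertices up to which the cops in M clear an arc whose
    ends are held by i and j.  The three cases are balanced so that the
    recursion of [clear_node] goes through. *)
Definition capacity (M : {set 'I_m}) i j : nat :=
  if i \in M then if j \in M then #|M| ^ 2 %/ 2 else (#|M| + 2) ^ 2 %/ 4 - 1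
  else if j \in M then (#|M| + 2) ^ 2 %/ 4 - 1 else 2 * #|M|.

Lemma capacityC M i j : capacity M i j = capacity M j i.
Proof. by rewrite /capacity; case: (i \in M); case: (j \in M). Qed.

(** The cops outside M hold S in. *)
Definition guarded C (M : {set 'I_m}) S := forall u v, S u -> adj u v ->
  S v \/ exists2 j, j \notin M & C j = v.

(** The cops in M clear the arc held by i and j while the cops outside M stay
    where they are and keep the rest S of the contaminated set in place.  The
    continuation says that the final positions of the cops in M do not
    matter. *)
Definition clearable_at (t : dtree G) M C i j S := i != j ->
  valid (C i) (C j) t -> walled (C i) (C j) (flat t) -> guarded C M S ->
  size (flat t) <= capacity M i j ->
  (forall C', (forall h, h \notin M -> C' h = C h) -> clears C' S) ->
  clears C (fun v => (v \in flat t) || S v).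

Definition clearable t := forall M C i j S, clearable_at t M C i j S.

(** Reading an arc backwards exchanges the roles of its two ends. *)
Lemma clearable_mirror t M C i j S :
  clearable_at (mirror t) M C j i S -> clearable_at t M C i j S.
Proof.
move=> cl ij vt wt gS st cont.
have := cl _ (valid_mirror vt) _ gS _ cont.
rewrite eq_sym ij flat_mirror size_rev capacityC => /(_ isT).
have wt' : walled (C j) (C i) (rev (flat t)).
  by apply: walled_sym wt => z; rewrite mem_rev.
move=> /(_ wt' st); apply: clears_sub => v; rewrite mem_rev => ->; exact: orbT.
Qed.

Lemma guarded_sub C M M' S : M' \subset M -> guarded C M S -> guarded C M' S.
Proof.
move=> MM' gS u v Su uv; case: (gS u v Su uv) => [|[j jM e]]; first by left.
by right; exists j => //; apply: contraNN jM; apply: (fintype.subsetP MM').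
Qed.

Lemma guarded_agree C C' M S : (forall h, h \notin M -> C' h = C h) ->
  guarded C M S -> guarded C' M S.
Proof.
move=> CC' gS u v Su uv; case: (gS u v Su uv) => [|[j jM e]]; first by left.
by right; exists j; rewrite // CC'.
Qed.

(** Cop h goes to the splitting vertex c.  The first half is cleared by M1,
    which leaves h and j in place to confine the robber to the second half; the
    second half is then cleared by M2.  Cop i becomes free to move for the
    second half if M2 contains it. *)
Lemma clear_split l c r M M1 M2 C i j h S :
  clearable l -> clearable r -> h \in M -> h != i -> h != j ->
  M1 \subset M -> h \notin M1 -> j \notin M1 -> M2 \subset M ->
  size (flat l) <= capacity M1 i h -> size (flat r) <= capacity M2 h j ->
  clearable_at (Node l c r) M C i j S.
Proof.
move=> cl cr hM hi hj M1M hM1 jM1 M2M sl sr ij [wl wr vl vr] wt gS _ cont.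
apply: (@clears_place _ _ h c).
  move=> u v /orP[ut|Su] uv; last first.
    case: (gS u v Su uv) => [->|[g gM <-]]; first by left; rewrite orbT.
    by right; exists g => //; apply: contraNneq gM => ->.
  case/or3P: (wt u v ut uv) => [->|/eqP->|/eqP->]; first by left.
    by right; exists i; rewrite // eq_sym.
  by right; exists j; rewrite // eq_sym.
set C1 := upd C h c.
have C1h : C1 h = c by rewrite updE eqxx.
have C1E g : g != h -> C1 g = C g by move=> /negbTE gh; rewrite updE gh.
have C1i : C1 i = C i by rewrite C1E // eq_sym.
have C1j : C1 j = C j by rewrite C1E // eq_sym.
pose S1 v := (v \in flat r) || S v.
apply: (@clears_sub _ (fun v => (v \in flat l) || S1 v)).
  move=> v /orP[|Sv]; last by rewrite /S1 Sv !orbT.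
  rewrite /= mem_cat inE => /or3P[->|/eqP->|vr']; rewrite ?orbT //.
    by apply/orP; left; apply/capturedP; exists h.
  by rewrite /S1 vr' !orbT.
have gS1 : guarded C1 M S.
  move=> u v Su uv; case: (gS u v Su uv) => [|[g gM <-]]; first by left.
  by right; exists g; rewrite // C1E //; apply: contraNneq gM => ->.
apply: (cl M1 C1 i h S1) => //; rewrite ?C1h ?C1i // 1?eq_sym //.
  move=> u v /orP[ur|Su] uv.
    case/or3P: (wr u v ur uv) => [vr'|/eqP->|/eqP->].
    - by left; rewrite /S1 vr'.
    - by right; exists h.
    - by right; exists j.
  case: (guarded_sub M1M gS1 Su uv) => [Sv|]; last by right.
  by left; rewrite /S1 Sv orbT.
move=> C2 C21.
have C2h : C2 h = c by rewrite C21.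
have C2j : C2 j = C j by rewrite C21.
have C2M g : g \notin M -> C2 g = C g.
  move=> gM; rewrite C21 ?C1E //; first by apply: contraNneq gM => ->.
  by apply: contraNN gM; apply: (fintype.subsetP M1M).
apply: (cr M2 C2 h j S) => //; rewrite ?C2h ?C2j //.
  by apply: guarded_sub M2M _; apply: guarded_agree gS.
move=> C3 C32; apply: cont => g gM; rewrite C32 ?C2M //.
by apply: contraNN gM; apply: (fintype.subsetP M2M).
Qed.

(** When c is adjacent to the end held by j along the cycle, j advances to c
    with no help from another cop. *)
Lemma clear_slide l c M C i j S : clearable l -> j \in M ->
  size (flat l) <= capacity M i j -> clearable_at (Node l c Leaf) M C i j S.
Proof.
move=> cl jM sl ij [wl _ vl cj] _ gS _ cont.
set C1 := upd C j c.
have C1E g : g != j -> C1 g = C g by move=> /negbTE gh; rewrite updE gh.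
have C1j : C1 j = c by rewrite updE eqxx.
have neq g : g \notin M -> g != j by apply: contraNneq => ->.
apply: (@clears_slide _ _ (fun v => (v \in flat l) || S v) j c).
- by rewrite adj_sym.
- move=> u v uS uc /orP[/eqP<-|uv].
    constructor 1; case/orP: uS => [|->]; last exact: orbT.
    by rewrite /= mem_cat inE (negbTE uc) orbF => ->.
  case/orP: uS => [|Su].
    rewrite /= mem_cat inE (negbTE uc) orbF => ul.
    case/or3P: (wl u v ul uv) => [->|/eqP->|/eqP->].
    + by constructor 1.
    + by constructor 3; exists i.
    + by constructor 2.
  case: (gS u v Su uv) => [->|[g gM <-]]; first by constructor 1; rewrite orbT.
  by constructor 3; exists g; rewrite // neq.
apply: (cl M C1 i j S); rewrite ?C1j ?(C1E _ ij) //.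
  apply: guarded_agree gS => g gM; exact: C1E (neq _ gM).
by move=> C' C'1; apply: cont => g gM; rewrite C'1 // C1E // neq.
Qed.

Lemma size_mirror (t : dtree G) : size (flat (mirror t)) = size (flat t).
Proof. by rewrite flat_mirror size_rev. Qed.

Lemma flat_nil (t : dtree G) : size (flat t) = 0 -> t = Leaf.
Proof. by case: t => //= l c r; rewrite size_cat /= addnS. Qed.

Lemma mirrorK : involutive (@mirror G).
Proof. by elim=> //= l -> c r ->. Qed.

Lemma square_mod4 p : p ^ 2 %% 4 <= 1.
Proof.
rewrite -modnXm; have : p %% 4 < 4 by rewrite ltn_mod.
by move: (p %% 4) => [|[|[|[|?]]]].
Qed.

Lemma sq_ge p : 4 * p <= p ^ 2 + 4.
Proof. by have := (nat_AGM2 p 2).1; rewrite sqrnD; move: (p ^ 2) => X; lia. Qed.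

(** A cop that is free to be sent to the splitting vertex. *)
Lemma exists_other M (B : {set 'I_m}) : #|B| < #|M| ->
  exists2 h, h \in M & h \notin B.
Proof.
move=> BM; apply/exists_inP; apply: contraTT BM; rewrite negb_exists_in -leqNgt.
move=> /forall_inP MB; apply: subset_leq_card; apply/fintype.subsetP => h hM.
by have := MB h hM; rewrite negbK.
Qed.

(** By symmetry, j is the more mobile of the two end cops, and the first half
    is the smaller one when both have the same mobility.  If both are mobile,
    the smaller half is cleared first, with i mobile and the other two
    holding.  If none is, h holds the splitting vertex while the others clear
    the smaller half between fixed ends, and then h is mobile for the larger
    one.  If only j is, either the half next to j is small enough to be cleared
    first while i waits, or the half next to i is so small that it can be
    cleared between fixed ends, and then both h and j are mobile.  With too few
    cops for that, the arc has so few vertices that an end cop can slide. *)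
Lemma clear_node l c r M C i j S : clearable l -> clearable r ->
  clearable (mirror l) -> clearable (mirror r) ->
  (i \in M -> j \in M) ->
  ((i \in M) = (j \in M) -> size (flat l) <= size (flat r)) ->
  clearable_at (Node l c r) M C i j S.
Proof.
move=> cl cr cl' cr' iMj lr ij vt wt gS st cont.
have sz : size (flat l) + size (flat r) < capacity M i j.
  by move: st; rewrite /= size_cat /= addnS.
(* squares are 0 or 1 modulo 4, which makes the rounded bounds fit exactly *)
have sq4 := square_mod4.
have mirrored h M1 M2 : h \in M -> h != i -> h != j -> M1 \subset M ->
    h \notin M1 -> i \notin M1 -> M2 \subset M ->
    size (flat r) <= capacity M1 j h -> size (flat l) <= capacity M2 h i ->
    clears C (fun v => (v \in flat (Node l c r)) || S v).
  move=> *; apply: (clearable_mirror _ ij vt wt gS st cont).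
  by apply: (@clear_split _ _ _ M M1 M2 C j i h) => //; rewrite size_mirror.
have direct h M1 M2 : h \in M -> h != i -> h != j -> M1 \subset M ->
    h \notin M1 -> j \notin M1 -> M2 \subset M ->
    size (flat l) <= capacity M1 i h -> size (flat r) <= capacity M2 h j ->
    clears C (fun v => (v \in flat (Node l c r)) || S v).
  by move=> *; apply: (@clear_split _ _ _ M M1 M2 C i j h).
have cardD1 h : h \in M -> #|M :\ h| = #|M| - 1.
  by move=> hM; rewrite [in RHS](finset.cardsD1 h) hM addKn.
have cardD2 h g : h \in M -> g \in M -> h != g -> #|M :\ h :\ g| = #|M| - 2.
  move=> hM gM hg; rewrite -[2]/(1 + 1) subnDA -(cardD1 h) //.
  by rewrite [in RHS](finset.cardsD1 g) finset.in_setD1 eq_sym hg gM addKn.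
have subD1 h : M :\ h \subset M by exact: finset.subD1set.
have subD2 h g : M :\ h :\ g \subset M.
  exact: fintype.subset_trans (finset.subD1set _ _) (subD1 h).
have inD := finset.in_setD1.
move: iMj lr sz; rewrite /capacity.
case: (boolP (i \in M)) => iM; case: (boolP (j \in M)) => jM //=.
- move=> _ /(_ erefl) le sz.
  have p2 : 1 < #|M| by apply/card_gt1P; exists i, j.
  have [p3|p3] := leqP 3 #|M|.
    have [|h hM] := @exists_other M (i |: [set j]).
      by rewrite finset.cards2 ij.
    rewrite finset.in_set2 negb_or => /andP[hi hj].
    apply: (direct h (M :\ h :\ j) M) => //.
    + by rewrite !finset.in_setD1 eqxx andbF.
    + by rewrite !finset.in_setD1 eqxx.
    + rewrite /capacity !finset.in_setD1 eqxx (eq_sym i h) hi ij iM andbF /= cardD2 // subnK //.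
      by move: sz le (sq4 #|M|); move: (#|M| ^ 2) => X; lia.
    + by rewrite /capacity hM jM; lia.
  have e2 : #|M| = 2 by lia.
  rewrite e2 in sz; have l0 : size (flat l) = 0 by lia.
  apply: (clearable_mirror _ ij vt wt gS st cont); rewrite (flat_nil l0).
  apply: clear_slide => //; rewrite size_mirror /capacity iM jM e2; lia.
- by move=> /(_ isT).
- move=> _ _ sz.
  have [p2|p1] := leqP 2 #|M|.
    have [|h hM] := @exists_other M [set j]; first by rewrite finset.cards1.
    rewrite finset.in_set1 => hj.
    have hi : h != i by apply: contraNneq iM => <-.
    have [A|A] := leqP (size (flat r)) ((#|M| + 1) ^ 2 %/ 4 - 1).
      apply: (mirrored h (M :\ h) M) => //.
      * by rewrite inD eqxx.
      * by rewrite inD (negbTE iM) andbF.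
      * rewrite /capacity !inD eqxx jM (eq_sym j) hj /= cardD1 //.
        by move: A; rewrite (_ : #|M| - 1 + 2 = #|M| + 1); last lia.
      * by rewrite /capacity hM (negbTE iM); lia.
    apply: (direct h (M :\ h :\ j) M) => //.
    + by rewrite !inD eqxx andbF.
    + by rewrite !inD eqxx.
    + rewrite /capacity !inD eqxx (negbTE iM) !andbF /= cardD2 //.
      move: sz A p2; rewrite !sqrnD; move: (#|M|) => p; move: (p ^ 2) => X; lia.
    + rewrite /capacity hM jM; move: sz (sq_ge #|M|); rewrite !sqrnD.
      by move: (#|M|) => p; move: (p ^ 2) => X; lia.
  have e1 : #|M| = 1.
    by apply/eqP; rewrite eqn_leq -ltnS p1; apply/card_gt0P; exists j.
  rewrite e1 in sz; have l0 : size (flat l) = 0 by lia.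
  have r0 : size (flat r) = 0 by lia.
  move: (ij) (vt) (wt) (gS) (st) (cont); rewrite (flat_nil r0).
  by apply: clear_slide => //; rewrite l0.
- move=> _ /(_ erefl) le sz.
  have [|h hM _] := @exists_other M finset.set0.
    by rewrite finset.cards0 lt0n; apply: contraTneq sz => ->.
  have hi : h != i by apply: contraNneq iM => <-.
  have hj : h != j by apply: contraNneq jM => <-.
  apply: (direct h (M :\ h) M) => //.
  + by rewrite inD eqxx.
  + by rewrite inD (negbTE jM) andbF.
  + rewrite /capacity !inD eqxx (negbTE iM) andbF /= cardD1 //.
    by move: sz le; move: (#|M|) => p; lia.
  + rewrite /capacity hM (negbTE jM) sqrnD; move: sz (sq_ge #|M|).
    by move: (#|M|) => p; move: (p ^ 2) => X; lia.
Qed.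

Lemma clearable_all t : clearable t.
Proof.
have [n] := ubnP (size (flat t)); elim: n t => // n IH [|l c r].
  by move=> _ M C i j S _ _ _ _ _ cont; apply: cont.
rewrite /= size_cat /= => szn.
have cl : clearable l by apply: IH; lia.
have cr : clearable r by apply: IH; lia.
have cl' : clearable (mirror l) by apply: IH; rewrite size_mirror; lia.
have cr' : clearable (mirror r) by apply: IH; rewrite size_mirror; lia.
move=> M C i j S.
have [/andP[h1 h2]|] := boolP (((i \in M) ==> (j \in M)) &&
    (((i \in M) == (j \in M)) ==> (size (flat l) <= size (flat r)))).
  apply: clear_node => //; first exact/implyP.
  by move=> e; move: h2; rewrite e eqxx.
move=> nh; apply: clearable_mirror; apply: clear_node; rewrite ?mirrorK ?size_mirror //.
  by move: nh; case: (i \in M); case: (j \in M).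
by move: nh; case: (i \in M); case: (j \in M) => //=; rewrite -ltnNge => /ltnW.
Qed.

End Clearing.

Lemma two_arcs_cops_win (G : sgraph) (k m : nat) (x y : G) (t t' : dtree G) :
  (forall u v : G, exists2 p, path (@adj G) u p & last u p = v) ->
  valid x y t -> walled x y (flat t) -> valid y x t' -> walled y x (flat t') ->
  (forall z, [|| z \in flat t, z \in flat t', z == x | z == y]) ->
  1 < m -> size (flat t) <= 2 * (m - 2) -> size (flat t') <= m ^ 2 %/ 2 ->
  cops_win G k m.
Proof.
move=> Gconn vt wt vt' wt' cover m1 st st'.
have /card_gt1P[i [j [_ _ ij]]] : 1 < #|'I_m| by rewrite card_ord.
pose C : positions G m := [ffun h => if h == i then x else y].
have Ci : C i = x by rewrite ffunE eqxx.
have Cj : C j = y by rewrite ffunE eq_sym (negbTE ij).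
apply: (clears_cops_win (C := C)).
apply: (@clears_sub _ _ _ (fun v => (v \in flat t) || (v \in flat t'))).
  move=> v _; case/or4P: (cover v) => [->|->|/eqP->|/eqP->]; rewrite ?orbT //.
    by apply/orP; left; apply/capturedP; exists i.
  by apply/orP; left; apply/capturedP; exists j.
(* first phase: the cops on x and y hold, the others clear t *)
pose M : {set 'I_m} := finset.setC (i |: [set j]).
have iM : i \notin M by rewrite finset.in_setC finset.setU11.
have jM : j \notin M by rewrite finset.in_setC finset.setU1r // finset.set11.
have cM : #|M| = m - 2.
  by rewrite -[m in RHS]card_ord -(finset.cardsC (i |: [set j])) finset.cards2 ij addKn.
apply: (clearable_all Gconn (M := M) (i := i) (j := j)); rewrite ?Ci ?Cj //.
- move=> u v ut uv; case/or3P: (wt' u v ut uv) => [->|/eqP->|/eqP->]; first by left.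
    by right; exists j.
  by right; exists i.
- by rewrite /capacity (negbTE iM) (negbTE jM) cM.
move=> C' C'C.
have C'i : C' i = x by rewrite C'C.
have C'j : C' j = y by rewrite C'C.
(* second phase: only t' is contaminated, and all cops may move *)
apply: (@clears_sub _ _ _ (fun v => (v \in flat t') || false)).
  by move=> v ->; rewrite orbT.
apply: (clearable_all Gconn (M := finset.setT) (i := j) (j := i) (S := pred0));
  rewrite ?C'i ?C'j 1?eq_sym //.
  by rewrite /capacity !finset.in_setT finset.cardsT card_ord.
by move=> C3 _; exact: clears_done.
Qed.

Theorem theta_free_cops_win (G : sgraph) (k m : nat) :
  k_connected G 2 -> theta_free G -> 5 <= #|G| ->
  m ^ 2 <= 2 * #|G| < m.+1 ^ 2 -> cops_win G k m.
Proof.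
move=> kG tf G5 /andP[mG Gm].
have m3 : 2 < m.
  rewrite ltnNge; apply: contraTN Gm => m2; rewrite -leqNgt.
  apply: (@leq_trans 9); last by lia.
  by rewrite (@leq_exp2r _ 3 2).
have mn : m <= #|G|.
  rewrite leqNgt; apply: contraTN mG => nm; rewrite -ltnNge.
  by apply: (@leq_trans (#|G|.+1 ^ 2)); rewrite ?leq_exp2r // -mulnn; lia.
have [||x [y [t [t' [[vt wt] [vt' wt'] sz st cover]]]]] := @two_arcs G (m - 2) kG tf G5.
- by lia.
- by lia.
have Gconn (u v : G) : exists2 p, path (@adj G) u p & last u p = v.
  have [|||p [pp _ lp _]] := @connected_path G finset.set0 u v; last by exists p.
  - by apply: kG.2; rewrite finset.cards0.
  - by rewrite finset.in_set0.
  - by rewrite finset.in_set0.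
apply: (two_arcs_cops_win k Gconn vt wt vt' wt' cover (ltnW m3)).
  by move: st; lia.
move: mG Gm sz st m3; rewrite -[m.+1]addn1 sqrnD; move: (#|G|) (m ^ 2) => n X; lia.
Qed.

(** * Winding numbers and theta curves in the plane *)

Local Open Scope classical_set_scope.
Local Open Scope ring_scope.

Section Quadrant.
Variable R : realType.
Implicit Types u v : R * R.

(** The quadrant of a nonzero vector, counted counterclockwise; each quadrant
    contains exactly one of its two bounding half-axes. *)
Definition quad u : int :=
  if (0 < u.1) && (0 <= u.2) then 0
  else if (u.1 <= 0) && (0 < u.2) then 1
  else if (u.1 < 0) && (u.2 <= 0) then 2 else 3.

(** For the maximum norm, a vector in the opposite quadrant is at distance at
    least the norm of u.  The difference 3 is the passage between the quadrants
    0 and 3, which are neighbours. *)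
Lemma quad_close u v : `|v - u| < `|u| ->
  (`|quad v - quad u| <= 1) || (`|quad v - quad u| == 3).
Proof.
rewrite !prod_normE /= => h.
have {h} : (`|v.1 - u.1| < `|u.1| /\ `|v.2 - u.2| < `|u.1|) \/
       (`|v.1 - u.1| < `|u.2| /\ `|v.2 - u.2| < `|u.2|).
  move: h; rewrite /Num.max; do 2 case: ifP; move=> *; [right|left|right|left]; split; lra.
case: u v => [a b] [c d] /=; rewrite /quad /= => -[].
all: case: (ltrgt0P a) => ?; case: (ltrgt0P b) => ?; rewrite ?normr0.
all: case: (ltrgt0P c) => ?; case: (ltrgt0P d) => ?; move=> [] //=.
all: rewrite ?ltr_norml; lra.
Qed.

Lemma quad_opp u : u != 0 -> (quad (- u) = quad u + 2 %[mod 4])%Z.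
Proof.
case: u => a b; rewrite xpair_eqE /quad /= !oppr_gt0 !oppr_ge0 !oppr_lt0 !oppr_le0.
by case: (ltrgt0P a); case: (ltrgt0P b).
Qed.

End Quadrant.

Section Lift.
Variable R : realType.
Local Notation plane := (R * R)%type.

(** A continuous argument in quarter turns, up to rounding: an integer in the
    class of the quadrant that locally changes by at most 1.  Two lifts differ
    by a multiple of 4 that locally changes by at most 2, hence is locally
    constant ([lift_unique]). *)
Definition lift (T : topologicalType) (A : set T) (g : T -> plane)
    (L : T -> int) :=
  forall p, A p -> (L p = quad (g p) %[mod 4])%Z /\
    \forall q \near p, A q -> `|L q - L p| <= 1.

Section Theory.
Variable T : topologicalType.
Implicit Types (A B : set T) (g : T -> plane) (L : T -> int).

Lemma connected_near_const (U : Type) A (f : T -> U) p q : connected A ->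
  (forall x, A x -> \forall y \near x, A y -> f y = f x) ->
  A p -> A q -> f p = f q.
Proof.
move=> cA fA Ap Aq.
have op V : open (\bigcup_(x in A `&` f @^-1` V)
     [set y | A y -> f y = f x]^°).
  by apply: bigcup_open => x _; exact: open_interior.
have memop V y : A y -> V (f y) -> (\bigcup_(x in A `&` f @^-1` V)
     [set y | A y -> f y = f x]^°) y.
  by move=> Ay Vy; exists y => //; exact: fA.
have opmem V y : A y -> (\bigcup_(x in A `&` f @^-1` V)
     [set y | A y -> f y = f x]^°) y -> V (f y).
  by move=> Ay [x [Ax Vx] /nbhs_singleton /(_ Ay) ->].
have eqA : A `&` [set x | f x = f q] = A.
  apply: cA; first by exists q.
  - exists (\bigcup_(x in A `&` f @^-1` [set f q])
     [set y | A y -> f y = f x]^°); first exact: op.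
    by apply/seteqP; split => y [Ay] h; split=> //; [exact: memop|exact: (opmem [set f q])].
  - exists (~` \bigcup_(x in A `&` f @^-1` (~` [set f q]))
     [set y | A y -> f y = f x]^°); first by apply: open_closedC; exact: op.
    apply/seteqP; split => y [Ay] h; split => //.
      by move=> /(opmem (~` [set f q]) _ Ay); apply.
    by apply: contrapT => nfy; apply: h; exact: memop.
by move: Ap; rewrite -eqA => -[].
Qed.

Lemma lift_sub A B g L : B `<=` A -> lift A g L -> lift B g L.
Proof.
move=> BA lL p /BA /lL[h1 h2]; split => //.
by apply: filterS h2 => q h /BA.
Qed.

Lemma lift_shift A g L k : (4 %| k)%Z -> lift A g L ->
  lift A g (fun p => L p + k).
Proof.
move=> k4 lL p /lL[h1 h2]; split; first by move: k4 h1; lia.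
by apply: filterS h2 => q h /h; lia.
Qed.

Lemma lift_opp A g L : (forall p, A p -> g p != 0) -> lift A g L ->
  lift A (fun p => - g p) (fun p => L p + 2).
Proof.
move=> g0 lL p Ap; have [h1 h2] := lL p Ap; split.
  by have := quad_opp (g0 p Ap); lia.
by apply: filterS h2 => q h /h; lia.
Qed.

Lemma lift_ext A g g' L : (forall p, A p -> g p = g' p) -> lift A g L ->
  lift A g' L.
Proof. by move=> gg lL p Ap; have [h1 h2] := lL p Ap; rewrite -gg. Qed.

Lemma lift_unique A g L L' p q : connected A -> lift A g L -> lift A g L' ->
  A p -> A q -> L p - L q = L' p - L' q.
Proof.
move=> cA lL lL' Ap Aq.
suff: L p - L' p = L q - L' q by lia.
apply: (connected_near_const (f := fun p => L p - L' p) cA) => // x Ax.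
have [h1 h2] := lL x Ax; have [h1' h2'] := lL' x Ax.
near=> y => Ay.
have : `|L y - L x| <= 1 by move: Ay; near: y.
have : `|L' y - L' x| <= 1 by move: Ay; near: y.
have [+ _] := lL y Ay; have [+ _] := lL' y Ay; lia.
Unshelve. all: by end_near. Qed.

Lemma lift_glue A B g L L' : closed A -> closed B ->
  (forall p, A p -> B p -> L p = L' p) -> lift A g L -> lift B g L' ->
  exists M, [/\ lift (A `|` B) g M, (forall p, A p -> M p = L p) &
    (forall p, B p -> M p = L' p)].
Proof.
move=> clA clB LL' lL lL'.
pose M p := if `[< A p >] then L p else L' p.
have MA p : A p -> M p = L p by move=> Ap; rewrite /M asboolT.
have MB p : B p -> M p = L' p.
  by move=> Bp; rewrite /M; case: asboolP => // Ap; exact: LL'.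
exists M; split=> // p ABp; split.
  by case: ABp => h; [rewrite MA //; case: (lL p h)|rewrite MB //; case: (lL' p h)].
have hA : \forall q \near p, A q -> `|M q - M p| <= 1.
  have [Ap|nAp] := pselect (A p).
    by rewrite MA //; have [_] := lL p Ap; apply: filterS => q h Aq; rewrite MA //; exact: h.
  have : \forall q \near p, (~` A) q by apply: open_nbhs_nbhs; split=> //; exact: closed_openC.
  by apply: filterS => q nAq /nAq.
have hB : \forall q \near p, B q -> `|M q - M p| <= 1.
  have [Bp|nBp] := pselect (B p).
    by rewrite MB //; have [_] := lL' p Bp; apply: filterS => q h Bq; rewrite MB //; exact: h.
  have : \forall q \near p, (~` B) q by apply: open_nbhs_nbhs; split=> //; exact: closed_openC.
  by apply: filterS => q nBq /nBq.
by apply: filterS2 hA hB => q h1 h2 [].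
Qed.

End Theory.

Lemma lift_comp (T U : topologicalType) (A : set T) (B : set U)
    (phi : U -> T) (g : T -> plane) L : continuous phi ->
  (forall x, B x -> A (phi x)) -> lift A g L -> lift B (g \o phi) (L \o phi).
Proof.
move=> cphi BA lL x Bx; have [h1 h2] := lL _ (BA x Bx); split=> //=.
have := cphi x _ h2; rewrite /nbhs /=.
by apply: filterS => y h /BA; exact: h.
Qed.

(** A uniform scale at which a nonvanishing function cannot reach the
    opposite quadrant, hence has lifts. *)
Lemma fine_mesh (T : pseudoMetricType R) (A : set T) (g : T -> plane) :
  compact A -> continuous g -> (forall p, A p -> g p != 0) ->
  exists2 d : R, 0 < d &
    forall p q, A p -> ball p d q -> `|g q - g p| < `|g p|.
Proof.
move=> cA cg g0.
have := @compact_near_coveringP T A => -[/(_ cA) + _].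
move=> /(_ R (0^'+) (fun d p => forall q, ball p d q -> `|g q - g p| < `|g p|)).
have hloc x : A x -> \forall x' \near x & i \near 0^'+,
    (forall q : T, ball x' i q -> `|g q - g x'| < `|g x'|).
  move=> Ax; (* within this radius of g x, vectors differ by less than their norms *)
  pose e : R := `|g x| / 4.
  have e0 : 0 < e by rewrite divr_gt0 // normr_gt0 g0.
  have : \forall q \near x, ball (g x) e (g q).
    by apply: (cg x); exact: nbhsx_ballx.
  move=> /nbhs_ballP[/= r r0 hr].
  exists (ball x (r / 2), [set d | d < r / 2]) => /=.
    split; first by apply: nbhsx_ballx; rewrite divr_gt0.
    by apply: nbhs_right_lt; rewrite divr_gt0.
  move=> [y d] /= [xy dr] q yq.
  have hq : ball (g x) e (g q).
    apply: hr; rewrite (splitr r); apply: ball_triangle xy _.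
    by apply: le_ball yq; exact: ltW.
  have hy : ball (g x) e (g y).
    by apply: hr; apply: le_ball xy; move: (r0); lra.
  move: hq hy; rewrite prod_norm_ball /ball_ /= => hq hy.
  rewrite (distrC (g x) (g q)) /e in hq hy.
  have aux (a b c s t w : R) : 0 <= a -> s < a / 4 -> t < a / 4 -> a - b <= w -> w <= t ->
    c <= s + t -> c < b by lra.
  exact: (aux _ _ _ _ _ _ (normr_ge0 _) hq hy (ler_norm _) (ler_dist_dist _ _) (ler_distD _ _ _)).
move=> /(_ _ hloc)[d /= d0 hd].
exists (d / 2); first by rewrite divr_gt0.
move=> p q Ap; apply: (hd (d / 2)) => //=.
  by rewrite sub0r normrN gtr0_norm; move: (d0); lra.
by rewrite divr_gt0.
Qed.

End Lift.

Section Rectangle.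
Variable R : realType.
Local Notation plane := (R * R)%type.

Lemma lift_small (T : topologicalType) (A : set T) (g : T -> plane) :
  (forall p q, A p -> A q -> `|g q - g p| < `|g p|) -> exists L, lift A g L.
Proof.
move=> gA; have [->|/set0P[p0 Ap0]] := eqVneq A set0; first by exists (fun=> 0).
pose L p := quad (g p0) + ((quad (g p) - quad (g p0) + 1) %% 4)%Z - 1.
exists L => p Ap; split; first by rewrite /L; lia.
apply: nearW => q Aq; rewrite /L.
have := quad_close (gA _ _ Ap0 Ap); have := quad_close (gA _ _ Ap0 Aq).
have := quad_close (gA _ _ Ap Aq); lia.
Qed.

Lemma lift_union (T : topologicalType) (A B : set T) (g : T -> plane) :
  closed A -> closed B -> connected (A `&` B) ->
  (exists L, lift A g L) -> (exists L, lift B g L) ->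
  exists L, lift (A `|` B) g L.
Proof.
move=> clA clB cAB [L lL] [L' lL'].
have [AB0|/set0P[p0 [Ap0 Bp0]]] := eqVneq (A `&` B) set0.
  have [|M [lM _ _]] := lift_glue (g := g) clA clB _ lL lL'; last by exists M.
  by move=> p Ap Bp; have : (A `&` B) p by []; rewrite AB0.
have k4 : (4 %| L p0 - L' p0)%Z.
  by have [+ _] := lL _ Ap0; have [+ _] := lL' _ Bp0; lia.
have [|M [lM _ _]] := lift_glue clA clB _ lL (lift_shift k4 lL'); last by exists M.
move=> p Ap Bp.
have := @lift_unique _ _ _ g L L' p p0 cAB _ _ (conj Ap Bp) (conj Ap0 Bp0).
move=> /(_ (lift_sub (@subIsetl _ _ _) lL) (lift_sub (@subIsetr _ _ _) lL')); lia.
Qed.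

Lemma interval_induction (P : R -> R -> Prop) (e a b : R) : 0 < e ->
  (forall x y, a <= x -> x <= y -> y <= b -> y - x < e -> P x y) ->
  (forall x y z, a <= x -> x <= y -> y <= z -> z <= b ->
     P x y -> P y z -> P x z) ->
  a <= b -> P a b.
Proof.
move=> e0 Psmall Pcat ab.
have Pn : forall n x, a <= x -> x <= b -> b - x < n.+1%:R * e -> P x b.
  elim=> [x ax xb|n IH x ax xb h].
    by rewrite mul1r => h; apply: Psmall.
  have [small|big] := ltP (b - x) e; first by apply: Psmall.
  have e2 : 0 < e / 2 by rewrite divr_gt0.
  apply: (@Pcat x (x + e / 2)) => //; try lra.
    by apply: Psmall; lra.
  apply: (Pcat _ (x + e / 2 + e / 2)); try lra.
    by apply: Psmall; lra.
  by apply: IH; lra.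
apply: (Pn (Num.truncn ((b - a) / e))) => //.
by rewrite -ltr_pdivrMr //; exact: truncnS_gt.
Qed.

Definition box (a b c d : R) : set plane := `[a, b] `*` `[c, d].

Lemma boxP a b c d (p : plane) :
  box a b c d p <-> [/\ a <= p.1, p.1 <= b, c <= p.2 & p.2 <= d].
Proof.
by rewrite /box /= !in_itv /=; split=> [[/andP[-> ->] /andP[-> ->]]|[-> -> -> ->]].
Qed.

Lemma box_compact a b c d : compact (box a b c d).
Proof. exact: (compact_setX (segment_compact (a:=a) (b:=b)) (segment_compact (a:=c) (b:=d))). Qed.

Lemma plane_hausdorff : hausdorff_space plane.
Proof. exact: (@norm_hausdorff R plane). Qed.

Lemma box_closed a b c d : closed (box a b c d).
Proof. exact: (compact_closed plane_hausdorff (@box_compact a b c d)). Qed.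

Lemma pair_continuous (s : R) : continuous (fun t : R => (s, t)).
Proof. by move=> t; exact: (cvg_pair (cvg_cst s) cvg_id). Qed.

Lemma pairl_continuous (t : R) : continuous (fun s : R => (s, t)).
Proof. by move=> s; exact: (cvg_pair cvg_id (cvg_cst t)). Qed.

Lemma box_connected a b c d : connected (box a b c d).
Proof.
have [|/set0P[[s0 t0] /boxP /= [h1 h2 h3 h4]]] := eqVneq (box a b c d) set0.
  by move=> ->; exact: connected0.
have -> : box a b c d = \bigcup_(t in `[c, d]%classic)
    ((fun s => (s, t)) @` `[a, b] `|` (fun t => (s0, t)) @` `[c, d]).
  apply/seteqP; split => [[s t] /boxP /= [*]|[s t]].
    by exists t; rewrite /= ?in_itv /=;
      [apply/andP|left; exists s; rewrite /= ?in_itv /=; [apply/andP|]].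
  move=> [y /=]; rewrite in_itv /= => /andP[? ?] [|] [x /=];
    rewrite in_itv /= => /andP[? ?] [<- <-];
   by apply/boxP.
apply: bigcup_connected.
  exists (s0, t0) => t /=; rewrite in_itv /= => /andP[? ?]; right; exists t0 => //=.
  by rewrite in_itv /=; apply/andP.
move=> t /=; rewrite in_itv /= => /andP[? ?]; apply: connectedU.
- by exists (s0, t); split; [exists s0|exists t]; rewrite //= in_itv /=; apply/andP.
- apply: connected_continuous_connected; first exact: segment_connected.
  by apply: continuous_subspaceT; exact: pairl_continuous.
- apply: connected_continuous_connected; first exact: segment_connected.
  by apply: continuous_subspaceT; exact: pair_continuous.
Qed.

Lemma boxU1 a m b c d : a <= m -> m <= b ->
  box a m c d `|` box m b c d = box a b c d.
Proof.
move=> am mb; apply/seteqP; split => p.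
  by case=> /boxP[*]; apply/boxP; split; lra.
move=> /boxP[*]; have [?|?] := leP p.1 m; [left|right]; apply/boxP; split; lra.
Qed.

Lemma boxU2 a b c m d : c <= m -> m <= d ->
  box a b c m `|` box a b m d = box a b c d.
Proof.
move=> am mb; apply/seteqP; split => p.
  by case=> /boxP[*]; apply/boxP; split; lra.
move=> /boxP[*]; have [?|?] := leP p.2 m; [left|right]; apply/boxP; split; lra.
Qed.

Lemma boxI a b c d a' b' c' d' : box a b c d `&` box a' b' c' d' =
  box (Num.max a a') (Num.min b b') (Num.max c c') (Num.min d d').
Proof.
apply/seteqP; split => p.
  move=> [/boxP[h1 h2 h3 h4] /boxP[h5 h6 h7 h8]].
  by apply/boxP; rewrite !ge_max !le_min h1 h2 h3 h4 h5 h6 h7 h8.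
move=> /boxP; rewrite !ge_max !le_min.
by move=> [/andP[? ?] /andP[? ?] /andP[? ?] /andP[? ?]]; split; apply/boxP.
Qed.

Lemma box_lift_union a b c d a' b' c' d' (g : plane -> plane) :
  (exists L, lift (box a b c d) g L) -> (exists L, lift (box a' b' c' d') g L) ->
  exists L, lift (box a b c d `|` box a' b' c' d') g L.
Proof.
apply: lift_union; [exact: box_closed|exact: box_closed|].
by rewrite boxI; exact: box_connected.
Qed.

(** Rectangles below the scale of [fine_mesh] have lifts, and lifts on
    adjacent rectangles can be made to agree on their connected intersection. *)
Lemma box_lift a b c d (g : plane -> plane) : a <= b -> c <= d ->
  continuous g -> (forall p, box a b c d p -> g p != 0) ->
  exists L, lift (box a b c d) g L.
Proof.
move=> ab cd cg g0.
have [e e0 he] := fine_mesh (box_compact (a:=a) (b:=b) (c:=c) (d:=d)) cg g0.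
apply: (@interval_induction (fun x y => exists L, lift (box x y c d) g L) e) => //.
- move=> x y ax xy yb yx.
  apply: (@interval_induction (fun z t => exists L, lift (box x y z t) g L) e) => //.
  + move=> z t cz zt td tz; apply: lift_small => p q /boxP[? ? ? ?] /boxP[? ? ? ?].
    apply: he; first by apply/boxP; split; lra.
    by rewrite prod_norm_ball /ball_ /= prod_normE /= gt_max !ltr_norml; lra.
  + move=> z t w cz zt tw wd h1 h2.
    by rewrite -(boxU2 _ _ zt tw); exact: box_lift_union.
- move=> x y z ax xy yz zb h1 h2.
  by rewrite -(boxU1 _ _ xy yz); exact: box_lift_union.
Qed.

End Rectangle.

Section Turn.
Variable R : realType.
Local Notation plane := (R * R)%type.
Implicit Types (P Q : R -> plane) (x : plane) (s t u : R).

(** In quarter turns, and meaningful when g has a lift on [c, d]. *)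
Definition variation (g : R -> plane) (c d : R) : int :=
  let L := xget (fun=> 0) [set L | lift `[c, d] g L] in L d - L c.

Lemma variationE g c d L : c <= d -> lift `[c, d] g L ->
  variation g c d = L d - L c.
Proof.
move=> cd lL; rewrite /variation; case: xgetP => [M _ lM|/(_ L)] //.
apply: lift_unique lM lL _ _; first exact: segment_connected.
  by rewrite /= bound_itvE.
by rewrite /= bound_itvE.
Qed.

Lemma variation_path (T : topologicalType) (A : set T) (g : T -> plane) L
    (phi : R -> T) h c d : lift A g L -> continuous phi -> c <= d ->
  (forall t, c <= t <= d -> A (phi t)) ->
  (forall t, c <= t <= d -> h t = g (phi t)) ->
  variation h c d = L (phi d) - L (phi c).
Proof.
move=> lL cphi cd Aphi hg.
apply: (@variationE _ _ _ (L \o phi)) => //.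
apply: (@lift_ext _ _ _ (g \o phi)); first by move=> t; rewrite /= in_itv /= => /hg.
by apply: lift_comp lL => // t; rewrite /= in_itv /=; exact: Aphi.
Qed.

Lemma variation_path_opp (T : topologicalType) (A : set T) (g : T -> plane) L
    (phi : R -> T) h c d : lift A g L -> (forall p, A p -> g p != 0) ->
  continuous phi -> c <= d ->
  (forall t, c <= t <= d -> A (phi t)) ->
  (forall t, c <= t <= d -> h t = - g (phi t)) ->
  variation h c d = L (phi d) - L (phi c).
Proof.
move=> lL g0 cphi cd Aphi hg.
rewrite (@variation_path _ A _ _ phi h c d (lift_opp g0 lL)) //; lia.
Qed.

Definition turn P x := variation (fun s => P s - x) 0 1.

(** The contribution of the ends of P to the winding around the inner point
    P t: it depends on P only, so it cancels between two paths that have the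
    same ends as P. *)
Definition corner P t :=
  variation (fun s => P 1 - P s) 0 t + variation (fun s => P 0 - P s) t 1.

Lemma diff_continuous P Q : continuous P -> continuous Q ->
  continuous (fun p : plane => P p.1 - Q p.2).
Proof.
move=> cP cQ p; apply: cvgB.
  by apply: (@continuous_comp _ _ _ fst P p); [exact: cvg_fst|exact: cP].
by apply: (@continuous_comp _ _ _ snd Q p); [exact: cvg_snd|exact: cQ].
Qed.

(** The lift of P s - Q t lives on two rectangles that avoid the parameters
    (0, 0) and (1, 1), where the difference vanishes, and that contain the
    segments s = tp and t = tq.  D is its change from (0, 1) to (1, 0).  The
    paths in parameter space that compute the two turns run from one of these
    corners to the other in opposite directions. *)
Lemma turn_pair P Q tp tq : continuous P -> continuous Q ->
  P 0 = Q 0 -> P 1 = Q 1 -> 0 < tp < 1 -> 0 < tq < 1 ->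
  (forall s t, 0 <= s <= 1 -> 0 <= t <= 1 -> P s = Q t ->
     (s = 0 /\ t = 0) \/ (s = 1 /\ t = 1)) ->
  exists D : int, [/\ (D = 2 %[mod 4])%Z,
    turn P (Q tq) = D + corner Q tq & turn Q (P tp) = - D + corner P tp].
Proof.
move=> cP cQ e0 e1 /andP[tp0 tp1] /andP[tq0 tq1] PQ.
pose g p : plane := P p.1 - Q p.2.
have cg : continuous g by exact: diff_continuous.
pose U := box 0 tp tq 1 `|` box tp 1 0 tq.
have g0 p : U p -> g p != 0.
  move=> Up; apply/eqP => /subr0_eq /PQ h.
  have [||[? ?]|[? ?]] := h; case: Up => /boxP[? ? ? ?]; clear e0 e1; lra.
have [L lL] : exists L, lift U g L.
  by apply: box_lift_union; apply: box_lift; rewrite ?ltW // => p Up;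
    apply: g0; [left|right].
have UP (s t : R) : U (s, t) <-> (0 <= s /\ s <= tp /\ tq <= t /\ t <= 1) \/
    (tp <= s /\ s <= 1 /\ 0 <= t /\ t <= tq).
  by rewrite /U; split=> [[] /boxP /= [*]|[] [? [? [? ?]]]];
    [left|right|left|right]=> //; apply/boxP.
have f1 : turn P (Q tq) = L (1, tq) - L (0, tq).
  apply: (variation_path lL (@pairl_continuous R tq)) => // t /andP[*].
  by apply/UP; have [?|?] := leP t tp; clear e0 e1; lra.
have f2 : turn Q (P tp) = L (tp, 1) - L (tp, 0).
  apply: (variation_path_opp lL g0 (@pair_continuous R tp)) => // t /andP[*].
    by apply/UP; have [?|?] := leP t tq; clear e0 e1; lra.
  by rewrite /g /= opprB.
have f3 : variation (fun t => Q 1 - Q t) 0 tq = L (1, tq) - L (1, 0).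
  apply: (variation_path lL (@pair_continuous R 1)); rewrite ?ltW // => t /andP[*].
    by apply/UP; clear e0 e1; lra.
  by rewrite /g /= e1.
have f4 : variation (fun t => Q 0 - Q t) tq 1 = L (0, 1) - L (0, tq).
  apply: (variation_path lL (@pair_continuous R 0)); rewrite ?ltW // => t /andP[*].
    by apply/UP; clear e0 e1; lra.
  by rewrite /g /= e0.
have f5 : variation (fun t => P 1 - P t) 0 tp = L (tp, 1) - L (0, 1).
  apply: (variation_path_opp lL g0 (@pairl_continuous R 1)); rewrite ?ltW // => t /andP[*].
    by apply/UP; clear e0 e1; lra.
  by rewrite /g /= -e1 opprB.
have f6 : variation (fun t => P 0 - P t) tp 1 = L (1, 0) - L (tp, 0).
  apply: (variation_path_opp lL g0 (@pairl_continuous R 0)); rewrite ?ltW // => t /andP[*].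
    by apply/UP; clear e0 e1; lra.
  by rewrite /g /= -e0 opprB.
exists (L (1, 0) - L (0, 1)); rewrite /corner f1 f2 f3 f4 f5 f6; split; last 2 first.
- by lia.
- by lia.
have U10 : U (1, 0) by apply/UP; clear e0 e1; lra.
have U01 : U (0, 1) by apply/UP; clear e0 e1; lra.
have [+ _] := lL _ U10; have [+ _] := lL _ U01.
have := quad_opp (g0 _ U01); rewrite /g /= opprB -e1 e0; lia.
Qed.

(** Around the rectangle of parameters (s, u) the total change of argument is
    zero.  The right-hand side depends on P only through its ends. *)
Lemma turn_deform P x y : continuous P ->
  (forall s u, 0 <= s <= 1 -> 0 <= u <= 1 -> P s != x + u *: (y - x)) ->
  turn P y - turn P x = variation (fun u => P 1 - (x + u *: (y - x))) 0 1
                      - variation (fun u => P 0 - (x + u *: (y - x))) 0 1.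
Proof.
move=> cP Pxy; pose l u : plane := x + u *: (y - x).
have cl : continuous l.
  move=> u; apply: cvgD; first exact: cvg_cst.
  by apply: cvgZl; exact: cvg_id.
pose g p : plane := P p.1 - l p.2.
have g0 p : box 0 1 0 1 p -> g p != 0.
  move=> /boxP[? ? ? ?]; rewrite subr_eq0; apply: Pxy; exact/andP.
have [L lL] : exists L, lift (box 0 1 0 1) g L.
  by apply: box_lift => //; exact: diff_continuous.
rewrite /turn.
have box01 s t : 0 <= s <= 1 -> 0 <= t <= 1 -> box 0 1 0 1 (s, t).
  by move=> /andP[? ?] /andP[? ?]; apply/boxP.
rewrite (variation_path lL (@pairl_continuous R 1)) //; first last.
- by move=> t ?; rewrite /g /l /= scale1r subrKC.
- by move=> t ?; apply: box01; rewrite // ler01 lexx.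
rewrite (variation_path lL (@pairl_continuous R 0)) //; first last.
- by move=> t ?; rewrite /g /l /= scale0r addr0.
- by move=> t ?; apply: box01; rewrite // ler01 lexx.
rewrite (variation_path lL (@pair_continuous R 1)) //; last first.
  by move=> t ?; apply: box01; rewrite // ler01 lexx.
rewrite (variation_path lL (@pair_continuous R 0)) //; last first.
  by move=> t ?; apply: box01; rewrite // ler01 lexx.
lia.
Qed.

Definition trace P : set plane := P @` `[0, 1].

Lemma trace_closed P : continuous P -> closed (trace P).
Proof.
move=> cP; apply: (compact_closed (@plane_hausdorff R)).
apply: continuous_compact; last exact: segment_compact.
exact: continuous_subspaceT.
Qed.

(** The winding of P followed by the reverse of Q when P and Q have the same
    ends. *)
Definition winding P Q x := turn P x - turn Q x.

Lemma winding_near P Q x : continuous P -> continuous Q ->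
  P 0 = Q 0 -> P 1 = Q 1 -> ~ trace P x -> ~ trace Q x ->
  \forall y \near x, winding P Q y = winding P Q x.
Proof.
move=> cP cQ e0 e1 Px Qx.
have : nbhs x (~` (trace P `|` trace Q)).
  apply: open_nbhs_nbhs; split; last by case.
  by apply: closed_openC; apply: closedU; exact: trace_closed.
move=> /nbhs_ballP[/= e e_gt0 he]; apply/nbhs_ballP; exists e => //= y xy.
have seg u : 0 <= u <= 1 -> (~` (trace P `|` trace Q)) (x + u *: (y - x)).
  move=> /andP[u0 u1]; apply: he; move: xy; rewrite prod_norm_ball /ball_ /=.
  rewrite opprD addNKr normrN prod_norm_scale ger0_norm // -normrN opprB.
  by apply: le_lt_trans; rewrite ler_piMl.
have off S : S = P \/ S = Q -> forall s u, 0 <= s <= 1 -> 0 <= u <= 1 ->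
    S s != x + u *: (y - x).
  move=> SPQ s u s01 u01; apply/eqP => eq; apply: (seg u u01); rewrite -eq.
  by case: SPQ => ->; [left|right]; exists s; rewrite //= in_itv.
have := turn_deform cQ (off Q (or_intror erefl)).
have := turn_deform cP (off P (or_introl erefl)).
rewrite /winding e0 e1; lia.
Qed.

End Turn.

Section Theta.
Variable R : realType.
Local Notation plane := (R * R)%type.
Implicit Types (P Q : R -> plane) (x : plane) (F : set plane).

Lemma winding_face P Q F x f : continuous P -> continuous Q ->
  P 0 = Q 0 -> P 1 = Q 1 -> connected F ->
  F `<=` ~` trace P -> F `<=` ~` trace Q ->
  closure F x -> ~ trace P x -> ~ trace Q x -> F f ->
  winding P Q x = winding P Q f.
Proof.
move=> cP cQ e0 e1 cF FP FQ Fx Px Qx Ff.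
have [y [Fy <-]] := Fx _ (winding_near cP cQ e0 e1 Px Qx).
apply: connected_near_const cF _ Fy Ff => z Fz.
have := winding_near cP cQ e0 e1 (FP _ Fz) (FQ _ Fz).
exact: filterS.
Qed.

Definition inner_disjoint P Q := forall s t, 0 <= s <= 1 -> 0 <= t <= 1 ->
  P s = Q t -> (s = 0 /\ t = 0) \/ (s = 1 /\ t = 1).

Lemma inner_disjoint_sym P Q : inner_disjoint P Q -> inner_disjoint Q P.
Proof. by move=> PQ s t hs ht /esym/(PQ _ _ ht hs)[] []; [left|right]. Qed.

Lemma inner_disjoint_off P Q t : inner_disjoint P Q -> 0 < t < 1 ->
  ~ trace Q (P t).
Proof.
move=> PQ /andP[t0 t1] [s] /=; rewrite in_itv /= => s01 eQ.
have t01 : 0 <= t <= 1 by rewrite !ltW.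
by have [[? _]|[? _]] := PQ t s t01 s01 (esym eQ); lra.
Qed.

(** By [turn_pair] the three windings around the inner points add up to twice
    an odd number of half turns; computed at one point of F they add up to
    zero. *)
Theorem theta_face P1 P2 P3 F t1 t2 t3 :
  continuous P1 -> continuous P2 -> continuous P3 ->
  P1 0 = P2 0 -> P2 0 = P3 0 -> P1 1 = P2 1 -> P2 1 = P3 1 ->
  inner_disjoint P1 P2 -> inner_disjoint P2 P3 -> inner_disjoint P1 P3 ->
  0 < t1 < 1 -> 0 < t2 < 1 -> 0 < t3 < 1 ->
  connected F -> F `<=` ~` trace P1 -> F `<=` ~` trace P2 ->
  F `<=` ~` trace P3 ->
  closure F (P1 t1) -> closure F (P2 t2) -> closure F (P3 t3) -> False.
Proof.
move=> c1 c2 c3 a12 a23 b12 b23 d12 d23 d13 ht1 ht2 ht3 cF F1 F2 F3 x1 x2 x3.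
have a13 : P1 0 = P3 0 by rewrite a12.
have b13 : P1 1 = P3 1 by rewrite b12.
have [f [Ff _]] : F `&` setT !=set0 by apply: x1; exact: filterT.
have [D12 [m12 u12 v12]] := turn_pair c1 c2 a12 b12 ht1 ht2 d12.
have [D23 [m23 u23 v23]] := turn_pair c2 c3 a23 b23 ht2 ht3 d23.
have [D13 [m13 u13 v13]] := turn_pair c1 c3 a13 b13 ht1 ht3 d13.
have := winding_face c1 c2 a12 b12 cF F1 F2 x3
  (inner_disjoint_off (inner_disjoint_sym d13) ht3)
  (inner_disjoint_off (inner_disjoint_sym d23) ht3) Ff.
have := winding_face c2 c3 a23 b23 cF F2 F3 x1
  (inner_disjoint_off d12 ht1) (inner_disjoint_off d13 ht1) Ff.
have := winding_face c1 c3 a13 b13 cF F1 F3 x2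
  (inner_disjoint_off (inner_disjoint_sym d12) ht2)
  (inner_disjoint_off d23 ht2) Ff.
rewrite /winding u12 v12 u23 v23 u13 v13; clear -m12 m23 m13; lia.
Qed.

End Theta.
(** * From drawings to theta curves *)

Section Drawing.
Variables (R : realType) (G : sgraph) (d : drawing R G).
Local Notation plane := (R * R)%type.
Implicit Types (a b u v x y z : G) (p q : seq G).

(** Precomposing with the projection on [0, 1] turns a curve that is
    continuous on [0, 1] into one that is continuous everywhere. *)
Definition clamp (s : R) : R := Num.max 0 (Num.min 1 s).

Lemma clamp_continuous : continuous clamp.
Proof.
move=> s; apply: (@continuous_max R R (fun=> 0) (fun s => Num.min 1 s) s).
  exact: cst_continuous.
apply: (@continuous_min R R (fun=> 1) id s); first exact: cst_continuous.
by move=> ?; exact: cvg_id.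
Qed.

Lemma clamp_itv s : 0 <= clamp s <= 1.
Proof. by rewrite /clamp /Num.max /Num.min; do 2 case: ifP; lra. Qed.

Lemma clamp_id s : 0 <= s <= 1 -> clamp s = s.
Proof. by rewrite /clamp /Num.max /Num.min; do 2 case: ifP; lra. Qed.

Lemma clamp_le0 s : s <= 0 -> clamp s = 0.
Proof. by rewrite /clamp /Num.max /Num.min; do 2 case: ifP; lra. Qed.

Lemma clamp_ge1 s : 1 <= s -> clamp s = 1.
Proof. by rewrite /clamp /Num.max /Num.min; do 2 case: ifP; lra. Qed.

Lemma curve_clamp_continuous x y : adj x y -> continuous (curve d x y \o clamp).
Proof.
move=> xy s V; have /subspace_continuousP cxy := @curve_continuous _ _ d _ _ xy.
have Vs : 0 <= clamp s <= 1 by exact: clamp_itv.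
move=> /(cxy (clamp s) Vs) Vclamp.
have h := @clamp_continuous s _ Vclamp.
by apply: (@filterS _ (nbhs s) _ _ _ _ h) => t /=; apply; exact: clamp_itv.
Qed.

(** One of the two terms is constant, equal to the common point g 1 = h 0, on
    each half of [0, 1].  As a sum of continuous functions the concatenation
    is continuous without a case analysis. *)
Definition concat (g h : R -> plane) (s : R) : plane :=
  g (clamp (2 * s)) + h (clamp (2 * s - 1)) - g 1.

Lemma concat_continuous g h : continuous g -> continuous h ->
  continuous (concat g h).
Proof.
move=> cg ch.
have c1 : continuous (fun t : R => 2 * t) by move=> t; apply: cvgMr; exact: cvg_id.
have c2 : continuous (fun t : R => 2 * t - 1).
  by move=> t; apply: cvgB; [exact: c1|exact: cvg_cst].
have ccomp (f : R -> plane) (l : R -> R) : continuous f -> continuous l ->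
    continuous (fun t => f (clamp (l t))).
  move=> cf cl t; apply: (@continuous_comp _ _ _ (clamp \o l) f t); last exact: cf.
  by apply: (@continuous_comp _ _ _ l clamp t); [exact: cl|exact: clamp_continuous].
have c0 : continuous (fun _ : R => g 1) by move=> ?; exact: cvg_cst.
by move=> s; exact: (cvgB (cvgD (ccomp _ _ cg c1 s) (ccomp _ _ ch c2 s)) (c0 s)).
Qed.

Lemma concatl g h s : g 1 = h 0 -> 0 <= s -> 2 * s <= 1 ->
  concat g h s = g (2 * s).
Proof.
by move=> gh *; rewrite /concat clamp_id ?clamp_le0 -?gh ?addrK //; clear gh; lra.
Qed.

Lemma concatr g h s : g 1 = h 0 -> 1 <= 2 * s -> s <= 1 ->
  concat g h s = h (2 * s - 1).
Proof.
move=> gh *; rewrite /concat clamp_ge1; last by clear gh; lra.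
by rewrite clamp_id ?[g 1 + _]addrC ?addrK //; clear gh; lra.
Qed.

(** The points that a drawn walk from a to b through p may cross strictly
    between its ends; of an edge only the open curve is kept, and one of its
    ends must be in p. *)
Definition inner a b p : set plane := [set w |
  (exists2 z, z \in p & w = pt d z) \/
  (exists u v t, [/\ adj u v, u \in [:: a, b & p], v \in [:: a, b & p],
     (u \in p) || (v \in p) & 0 < t < 1 /\ w = curve d u v t])].

Lemma walk_curve a b p x q : path (@adj G) x (rcons q b) -> x \in p ->
  {subset q <= p} -> exists g : R -> plane, [/\ continuous g, g 0 = pt d x,
    g 1 = pt d b & forall s, 0 <= s < 1 -> inner a b p (g s)].
Proof.
elim: q x => [|y q IH] x /=.
  rewrite andbT => xb xp _; exists (curve d x b \o clamp); split.
  - exact: curve_clamp_continuous.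
  - by rewrite /= clamp_id ?curve_start // lexx ler01.
  - by rewrite /= clamp_id ?curve_end // lexx ler01.
  - move=> s /andP[s0 s1] /=; rewrite clamp_id ?s0 ?ltW //.
    have [->|sn0] := eqVneq s 0; first by rewrite curve_start //; left; exists x.
    right; exists x, b, s; rewrite !inE xp eqxx !orbT; split=> //.
    by split=> //; rewrite s1 lt_neqAle eq_sym sn0 s0.
move=> /andP[xy yq] xp qp.
have yp : y \in p by apply: qp; rewrite mem_head.
have [|g [cg g0 g1 gi]] := IH y yq yp.
  by move=> z zq; apply: qp; rewrite inE zq orbT.
pose e := curve d x y \o clamp.
have e0 : e 0 = pt d x by rewrite /e /= clamp_id ?curve_start // lexx ler01.
have e1 : e 1 = g 0 by rewrite /e g0 /= clamp_id ?curve_end // lexx ler01.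
have ce : continuous e by exact: curve_clamp_continuous.
exists (concat e g); split.
- exact: concat_continuous.
- by rewrite concatl ?mulr0.
- by rewrite concatr ?mulr1 //; [rewrite -g1; congr g; lra|lra].
- move=> s /andP[s0 s1]; have [s2|s2] := leP (2 * s) 1.
    rewrite concatl // /e /= clamp_id; last by apply/andP; split; lra.
    have [->|sn0] := eqVneq s 0; first by rewrite mulr0 curve_start //; left; exists x.
    have [->|sn1] := eqVneq (2 * s) 1; first by rewrite curve_end //; left; exists y.
    right; exists x, y, (2 * s); rewrite !inE xp yp !orbT; split=> //; split=> //.
    by move: sn0 sn1; rewrite !neq_lt; clear -s0 s1 s2; lra.
  by rewrite concatr ?ltW //; apply: gi; clear -s1 s2; lra.
Qed.

(** The first inner vertex of the path is reached at time 1 / 2. *)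
Lemma path_curve a b p : path (@adj G) a (rcons p b) -> p != [::] ->
  exists g : R -> plane, [/\ continuous g, g 0 = pt d a, g 1 = pt d b,
    forall s, 0 < s < 1 -> inner a b p (g s) &
    exists2 z, z \in p & g (1 / 2) = pt d z].
Proof.
case: p => // y q /= /andP[ay yq] _.
have yp : y \in y :: q by rewrite mem_head.
have [|g [cg g0 g1 gi]] := walk_curve a yq yp.
  by move=> z zq; rewrite inE zq orbT.
pose e := curve d a y \o clamp.
have e0 : e 0 = pt d a by rewrite /e /= clamp_id ?curve_start // lexx ler01.
have e1 : e 1 = g 0 by rewrite /e g0 /= clamp_id ?curve_end // lexx ler01.
have ce : continuous e by exact: curve_clamp_continuous.
exists (concat e g); split.
- exact: concat_continuous.
- by rewrite concatl ?mulr0.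
- by rewrite concatr ?mulr1 //; [rewrite -g1; congr g; lra|lra].
- move=> s /andP[s0 s1]; have [s2|s2] := leP (2 * s) 1.
    rewrite (concatl e1 (ltW s0) s2) /e [X in inner _ _ _ X]/= clamp_id;
      last by apply/andP; split; lra.
    have [->|sn1] := eqVneq (2 * s) 1; first by rewrite curve_end //; left; exists y.
    right; exists a, y, (2 * s); rewrite !inE !eqxx /= !orbT; split=> //; split=> //.
    by move: sn1; rewrite !neq_lt; clear -s0 s1 s2; lra.
  by rewrite concatr ?ltW //; apply: gi; clear -s1 s2; lra.
- have half : 2 * (1 / 2) = 1 :> R by rewrite mul1r mulfV // pnatr_eq0.
  by exists y => //; rewrite (concatl e1) ?half // e1.
Qed.

Lemma inner_drawn a b p : inner a b p `<=` drawn d.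
Proof.
move=> w [[z _ ->]|[u [v [t [uv _ _ _ [t01 ->]]]]]]; first by left; exists z.
by right; exists u, v, t; split=> //; rewrite in_itv /=; move/andP: t01 => [? ?]; rewrite !ltW.
Qed.

Lemma inner_neq_end a b p z w : a \notin p -> b \notin p -> z \notin p ->
  inner a b p w -> w <> pt d z.
Proof.
move=> ap bp zp [[y yp ->] /pt_inj yz|[u [v [t [uv _ _ _ [t01 ->]]]]]].
  by rewrite -yz yp in zp.
by apply: (@curve_avoids_pt _ _ d _ _ z uv); rewrite in_itv.
Qed.

Lemma inner_disjointI a b p q w : a \notin p -> b \notin p -> a \notin q ->
  b \notin q -> (forall z, z \in p -> z \notin q) -> inner a b p w -> inner a b q w -> False.
Proof.
move=> ap bp aq bq pq.
have nq z : z \in p -> z \notin [:: a, b & q].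
  move=> zp; rewrite !inE !negb_or (pq _ zp) andbT.
  by apply/andP; split; apply: contraTneq zp => ->.
move=> [[z zp ->]|[u [v [t [uv up vp uvp [t01 ->]]]]]].
  by move=> /(inner_neq_end aq bq (pq _ zp)).
move=> [[z _ eqz]|].
  by apply: (@curve_avoids_pt _ _ d _ _ z uv t); rewrite ?in_itv.
move=> [u' [v' [t' [uv' uq vq _ [t01' eqc]]]]].
apply: (@curve_disjoint _ _ d _ _ _ _ uv uv' _ _ t t') => //; rewrite ?in_itv // => -[e1 e2];
  subst u' v'; by case/orP: uvp => /nq; rewrite ?uq ?vq.
Qed.

End Drawing.

Section ThetaFree.
Variables (R : realType) (G : sgraph).
Implicit Types (a b : G) (p q : seq G).

Variable d : drawing R G.

Definition joins (g : R -> R * R) a b p :=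
  [/\ continuous g, g 0 = pt d a, g 1 = pt d b &
    forall s, 0 < s < 1 -> inner d a b p (g s)].

Lemma joins_drawn g a b p : joins g a b p -> trace g `<=` drawn d.
Proof.
move=> [_ g0 g1 gi] w [s /=]; rewrite in_itv /= => /andP[s0 s1] <-.
have [->|n0] := eqVneq s 0; first by rewrite g0; left; exists a.
have [->|n1] := eqVneq s 1; first by rewrite g1; left; exists b.
by apply: (@inner_drawn _ _ d a b p); apply: gi; rewrite !lt_neqAle eq_sym n0 n1 s0.
Qed.

Lemma joins_disjoint g h a b p q : a != b -> a \notin p -> b \notin p ->
  a \notin q -> b \notin q -> (forall z, z \in p -> z \notin q) ->
  joins g a b p -> joins h a b q -> inner_disjoint g h.
Proof.
move=> ab ap bp aq bq pq [_ g0 g1 gi] [_ h0 h1 hi] s t.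
have ptab : pt d a <> pt d b by move=> /pt_inj /eqP; rewrite (negbTE ab).
have cases (x : R) : 0 <= x <= 1 -> [\/ x = 0, x = 1 | 0 < x < 1].
  move=> /andP[x0 x1]; have [->|n0] := eqVneq x 0; first by constructor 1.
  have [->|n1] := eqVneq x 1; first by constructor 2.
  by constructor 3; rewrite !lt_neqAle eq_sym n0 n1 x0.
move=> /cases[->|->|s01] /cases[->|->|t01]; rewrite ?g0 ?g1 ?h0 ?h1 => e.
- by left.
- by case: (ptab e).
- by case: (inner_neq_end aq bq aq (hi _ t01) (esym e)).
- by case: (ptab (esym e)).
- by right.
- by case: (inner_neq_end aq bq bq (hi _ t01) (esym e)).
- by case: (inner_neq_end ap bp ap (gi _ s01) e).
- by case: (inner_neq_end ap bp bp (gi _ s01) e).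
- case: (inner_disjointI ap bp aq bq pq (gi _ s01)).
  by rewrite e; exact: hi.
Qed.

Lemma face_theta_free F : face d F -> (forall x, closure F (pt d x)) ->
  theta_free G.
Proof.
move=> [w _ ->] Fpt a b p1 p2 p3 w1 w2 w3 u; apply: contraT.
rewrite !negb_or => /and3P[n1 n2 n3].
set F0 := connected_component _ _ in Fpt.
have cF : connected F0 by exact: component_connected.
have Fd : F0 `<=` ~` drawn d by exact: connected_component_sub.
move: u; rewrite /= !inE !mem_cat !cat_uniq has_cat !negb_or.
move=> /and3P[/and4P[ab a1 a2 a3] /and3P[b1 b2 b3] /and3P[_ /andP[d12 d13] /and3P[_ d23 _]]].
have dis p q : ~~ has (mem p) q -> forall z, z \in p -> z \notin q.
  by move=> /hasPn h z zp; apply/negP => /h; rewrite /= zp.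
have [g1 [c1 s1 e1 i1 [z1 _ m1]]] := path_curve d w1 n1.
have [g2 [c2 s2 e2 i2 [z2 _ m2]]] := path_curve d w2 n2.
have [g3 [c3 s3 e3 i3 [z3 _ m3]]] := path_curve d w3 n3.
have j1 : joins g1 a b p1 by [].
have j2 : joins g2 a b p2 by [].
have j3 : joins g3 a b p3 by [].
have half : 0 < (1 / 2 : R) < 1 by lra.
have off g p : joins g a b p -> F0 `<=` ~` trace g.
  by move=> jg z /Fd nz /(joins_drawn jg).
suff : False by [].
apply: (theta_face c1 c2 c3 _ _ _ _ _ _ _ half half half cF
  (off _ _ j1) (off _ _ j2) (off _ _ j3)); rewrite ?m1 ?m2 ?m3 //.
- by rewrite s1 s2.
- by rewrite s2 s3.
- by rewrite e1 e2.
- by rewrite e2 e3.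
- exact: joins_disjoint (dis _ _ d12) j1 j2.
- exact: joins_disjoint (dis _ _ d23) j2 j3.
- exact: joins_disjoint (dis _ _ d13) j1 j3.
Qed.

End ThetaFree.

Lemma outerplanar_theta_free (R : realType) (G : sgraph) :
  outerplanar R G -> theta_free G.
Proof. by move=> [d [F [dF _ clF]]]; exact: face_theta_free dF clF. Qed.

(** * The bound *)

Theorem proposition5p2 (R : realType) (k : nat) (G : sgraph) :
  (0 < k)%N -> (5 <= #|G|)%N -> k_connected G 2 -> outerplanar R G ->
  (hyperopic_cop_number G k)%:R <= Num.sqrt (2 * #|G|)%N%:R :> R.
Proof.
move=> _ G5 kG opG.
have [m mG Gm] : exists2 m : nat, (m ^ 2 <= 2 * #|G|)%N & (2 * #|G| < m.+1 ^ 2)%N.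
  have ex : exists m : nat, (m ^ 2 <= 2 * #|G|)%N by exists 0.
  have ub (m : nat) : (m ^ 2 <= 2 * #|G|)%N -> (m <= 2 * #|G|)%N.
    by apply: leq_trans; rewrite -mulnn; nia.
  case: (ex_maxnP ex ub) => m mG mmax; exists m => //.
  by rewrite ltnNge; apply/negP => /mmax; rewrite ltnn.
have win : cops_win G k m.
  apply: theta_free_cops_win kG (outerplanar_theta_free opG) G5 _.
  by rewrite mG Gm.
have cm : (hyperopic_cop_number G k <= m)%N.
  by rewrite /hyperopic_cop_number; case: ex_minnP => c _; apply; exact/asboolP.
rewrite -[X in X <= _]ger0_norm // -sqrtr_sqr ler_wsqrtr // -natrX ler_nat.
by apply: leq_trans mG; rewrite leq_exp2r.
Qed.
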